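(* Let $A, B, X \in \mathbb{C}(z)$ be rational functions of degree at least two such that $A\circ X = X\circ B$ and $\mathbb{C}(B,X)=\mathbb{C}(z)$. Then the Galois closure of the field extension $\mathbb{C}(z)/\mathbb{C}(X)$ has genus zero or one.
   Context: Rational functions are regarded as holomorphic maps $\mathbb{C}\mathbb{P}^1\to\mathbb{C}\mathbb{P}^1$; the degree is the degree of this map. $\mathbb{C}(B,X)$ denotes the subfield of $\mathbb{C}(z)$ generated over $\mathbb{C}$ by $B$ and $X$, and $\mathbb{C}(X)$ the subfield generated over $\mathbb{C}$ by $X$. The Galois closure of $\mathbb{C}(z)/\mathbb{C}(X)$ is a function field of one variable over $\mathbb{C}$, and its genus is the genus of the corresponding compact connected Riemann surface. Equivalently, it is the genus $g(\widetilde S_X)$, where the normalization $\widetilde X:\widetilde S_X\to\mathbb{C}\mathbb{P}^1$ of $X$ is the holomorphic map of the lowest possible degree between compact (connected) Riemann surfaces such that $\widetilde X$ is a Galois covering and $\widetilde X = X\circ H$ for some holomorphic map $H:\widetilde S_X\to\mathbb{C}\mathbb{P}^1$. *)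

(* Defs.v *)
From HB Require Import structures.
From mathcomp Require Import all_boot all_order all_algebra all_fingroup all_field.
From mathcomp Require Import fraction generic_quotient.
From mathcomp Require Import boolp classical_sets reals complex.

Set Implicit Arguments.
Unset Strict Implicit.
Unset Printing Implicit Defensive.

Import Order.TTheory GRing.Theory Num.Theory.
Local Open Scope classical_set_scope.
Local Open Scope ring_scope.

Section Subfields.
Variable K : fieldType.
Implicit Type S : set K.

Definition gen_subfield S : set K :=
  smallest [set M : set K | divring_closed [in M]] S.

Definition gen_pred S : pred K := [in gen_subfield S].

Lemma gen_pred_divring_closed S : divring_closed (gen_pred S).
Proof.
split=> [|x y|x y]; rewrite /gen_pred !inE.
- by move=> M [[M1 _ _] _]; move: M1; rewrite inE.
- move=> Sx Sy M CM; have [[_ MB _] _] := CM.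
  have := MB x y; rewrite !inE; apply; [exact: Sx|exact: Sy].
- move=> Sx Sy M CM; have [[_ _ MV] _] := CM.
  have := MV x y; rewrite !inE; apply; [exact: Sx|exact: Sy].
Qed.

HB.instance Definition _ S :=
  GRing.isDivringClosed.Build K (gen_pred S) (gen_pred_divring_closed S).

(* gen_subfield S as a field in its own right, with inclusion val into K. *)
Record gen_field S : Type :=
  GenField { gen_field_val : K; _ : gen_field_val \in gen_pred S }.

HB.instance Definition _ S := [isSub for @gen_field_val S].
HB.instance Definition _ S := [Choice of gen_field S by <:].
HB.instance Definition _ S := [SubChoice_isSubComUnitRing of gen_field S by <:].
HB.instance Definition _ S :=
  [SubComUnitRing_isSubIntegralDomain of gen_field S by <:].
HB.instance Definition _ S :=
  [SubIntegralDomain_isSubField of gen_field S by <:].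

(* L, together with j : K -> L, is a Galois closure of the extension of K over
   its subfield generated by S: it is Galois over that subfield, and no proper
   subextension containing j(K) is. *)
Definition galois_closure S (L : splittingFieldType (gen_field S))
    (j : {rmorphism K -> L}) : Prop :=
  [/\ forall a : gen_field S, j (val a) = a%:A,
      galois 1 {:L}
    & forall M : {subfield L},
        galois 1 M -> (forall f, j f \in M) -> M = {:L}%VS :> {vspace L}].

End Subfields.

Notation ratfun k := {fraction {poly k}}.

Section RationalFunctions.
Variable k : fieldType.

Definition rat_const : {rmorphism k -> ratfun k} :=
  @FracField.tofrac {poly k} \o polyC.

(* The representative of a fraction chosen by the library need not be in lowest
   terms, hence the division by the gcd. For f = p / q in lowest terms this is
   max (deg p) (deg q), the degree of the associated self-map of P^1. *)
Definition rat_degree (f : ratfun k) : nat :=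
  let p := \n_(repr f) in let q := \d_(repr f) in
  (maxn (size (p %/ gcdp p q)) (size (q %/ gcdp p q))).-1.

(* f o g. The value does not depend on the representative of f as soon as g is
   not constant; for constant g a zero of the denominator yields the junk
   value 0. *)
Definition rat_comp (f g : ratfun k) : ratfun k :=
  (map_poly rat_const \n_(repr f)).[g] / (map_poly rat_const \d_(repr f)).[g].

End RationalFunctions.

(* Generators over the constants: the subfield they generate is k(S). *)
Notation over_const S := (range (@rat_const _) `|` S).

Section Genus.
Variables (k L : fieldType) (e : {rmorphism k -> L}).

Definition derivation (V : lmodType L) (d : L -> V) : Prop :=
  [/\ forall a b, d (a + b) = d a + d b,
      forall a b, d (a * b) = a *: d b + b *: d a
    & forall c, d (e c) = 0].

(* d : L -> Omega is the universal k-derivation, i.e. Omega is the space of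
   Kaehler (that is, meromorphic) differentials of L / k. *)
Definition kaehler (Omega : lmodType L) (d : L -> Omega) : Prop :=
  derivation d /\
  forall (V : lmodType L) (delta : L -> V), derivation delta ->
    exists2 phi : {linear Omega -> V},
      forall a, phi (d a) = delta a
    & forall psi : {linear Omega -> V},
        (forall a, psi (d a) = delta a) -> psi =1 phi.

(* A point of the curve with function field L, given by the order of vanishing
   there: a normalized discrete valuation of L trivial on k. The value at 0 is
   junk. *)
Definition place (v : L -> int) : Prop :=
  [/\ forall x y, x != 0 -> y != 0 -> v (x * y) = v x + v y,
      forall x y, x != 0 -> y != 0 -> x + y != 0 ->
        Num.min (v x) (v y) <= v (x + y),
      forall c, c != 0 -> v (e c) = 0
    & exists2 t, t != 0 & v t = 1].

(* At every point, w = f dt with t a local parameter and f regular. *)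
Definition holomorphic (Omega : lmodType L) (d : L -> Omega) (w : Omega) : Prop :=
  forall v, place v ->
    exists t f, [/\ t != 0, v t = 1, f = 0 \/ 0 <= v f & w = f *: d t].

(* The genus of L / k is the dimension over k of the space of holomorphic
   differentials; b is a k-basis of that space. For k algebraically closed of
   characteristic 0 this is the genus of the corresponding curve. *)
Definition has_genus (g : nat) : Prop :=
  exists (Omega : lmodType L) (d : L -> Omega),
    kaehler d /\
    exists b : 'I_g -> Omega,
      (forall i, holomorphic d (b i)) /\
      forall w, holomorphic d w ->
        exists! c : {ffun 'I_g -> k}, w = \sum_(i < g) e (c i) *: b i.

End Genus.

(* Main.v *)
(* Let L be the Galois closure of k(z) / k(X), where k = R[i]. Substitution of B
   maps k(X) into itself, because X o B = A o X, and it maps the minimal polynomial of z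
   over k(X) to that of B, because k(B, X) = k(z). Hence it extends to an embedding phi of L
   into itself, whose pullback w |-> phi^* w preserves the space of holomorphic
   differentials. This space is finite-dimensional; if its dimension were at least 2,
   triangularizing the pullback would produce a nonconstant u in L with phi u = a u + b.
   Comparing the minimal polynomials of u and phi u over k(X) then gives a nonconstant
   rational function h with h o A = al h + be, which is impossible as deg A >= 2. *)
Require Import Defs.
From HB Require Import structures.
From mathcomp Require Import all_boot all_order all_algebra all_fingroup all_field.
From mathcomp Require Import fraction generic_quotient.
From mathcomp Require Import boolp classical_sets reals complex.
From mathcomp Require Import ring zify.

Set Implicit Arguments.
Unset Strict Implicit.
Unset Printing Implicit Defensive.

Import Order.TTheory GRing.Theory Num.Theory.
Local Open Scope classical_set_scope.
Local Open Scope ring_scope.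

(** * Maps out of rings of polynomials and their fraction fields *)

Section FractionFactor.
Variables (A : comPzRingType) (F : fieldType) (ev : {rmorphism A -> F}).
Hypothesis evF : forall u, exists a b, ev b != 0 /\ u = ev a / ev b.

Lemma rmorphism_factor (M : fieldType) (s : {rmorphism A -> M}) :
  (forall a, (s a == 0) = (ev a == 0)) ->
  exists f : {rmorphism F -> M}, forall a, f (ev a) = s a.
Proof.
move=> s0.
have cross a b a' b' : ev b != 0 -> ev b' != 0 ->
    ev a / ev b = ev a' / ev b' -> s a / s b = s a' / s b'.
  move=> nb nb' /eqP; rewrite eqr_div // -!rmorphM -subr_eq0 -rmorphB -s0.
  by rewrite rmorphB !rmorphM subr_eq0 -eqr_div ?s0 // => /eqP.
have [n /choice[d nd]] := choice evF.
pose f u := s (n u) / s (d u).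
have fE a b : ev b != 0 -> f (ev a / ev b) = s a / s b.
  move=> nb; have [nd' e] := nd (ev a / ev b).
  by apply: cross => //; rewrite -e.
have fB : zmod_morphism f.
  move=> u v; have [a [b [nb ->]]] := evF u; have [c [e [ne ->]]] := evF v.
  have -> : ev a / ev b - ev c / ev e = ev (a * e - c * b) / ev (b * e).
    by rewrite rmorphB !rmorphM; field; rewrite nb ne.
  rewrite !fE ?rmorphB ?rmorphM ?mulf_neq0 //.
  by field; rewrite !s0 nb ne.
have fM : monoid_morphism f.
  split=> [|u v].
    have -> : (1 : F) = ev 1 / ev 1 by rewrite rmorph1 divr1.
    by rewrite fE ?rmorph1 ?oner_neq0 // divr1.
  have [a [b [nb ->]]] := evF u; have [c [e [ne ->]]] := evF v.
  have -> : ev a / ev b * (ev c / ev e) = ev (a * c) / ev (b * e).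
    by rewrite !rmorphM mulf_div.
  by rewrite !fE ?rmorphM ?mulf_neq0 // mulf_div.
pose f1 := GRing.isZmodMorphism.Build F M f fB.
pose f2 := GRing.isMonoidMorphism.Build F M f fM.
pose fR : {rmorphism F -> M} := HB.pack f f1 f2.
exists fR => a /=; have := fE a 1.
by rewrite !rmorph1 !divr1 oner_neq0 => ->.
Qed.

Lemma derivation_factor (del : A -> F) :
  (forall a b, del (a + b) = del a + del b) ->
  (forall a b, del (a * b) = ev a * del b + ev b * del a) ->
  (forall a, ev a = 0 -> del a = 0) ->
  exists D : F -> F, [/\ forall u v, D (u + v) = D u + D v,
    forall u v, D (u * v) = u * D v + v * D u & forall a, D (ev a) = del a].
Proof.
move=> delD delM del0.
have delB a b : del (a - b) = del a - del b.
  by have := delD (a - b) b; rewrite subrK => ->; rewrite addrK.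
have cross a b a' b' : ev b != 0 -> ev b' != 0 ->
    ev a / ev b = ev a' / ev b' ->
    (del a * ev b - ev a * del b) / ev b ^+ 2 =
    (del a' * ev b' - ev a' * del b') / ev b' ^+ 2.
  move=> nb nb' /eqP; rewrite eqr_div // => /eqP e.
  have : del (a * b' - a' * b) = 0 by apply: del0; rewrite rmorphB !rmorphM e subrr.
  rewrite delB !delM => /eqP; rewrite subr_eq0 => /eqP e'.
  apply/eqP; rewrite eqr_div ?expf_neq0 //; apply/eqP.
  have -> : (del a * ev b - ev a * del b) * ev b' ^+ 2 =
    ev b * ev b' * (ev a * del b' + ev b' * del a) - 
      (ev a * ev b' * del b * ev b' + ev a * ev b' * del b' * ev b) by ring.
  by rewrite e' e; ring.
have [n /choice[d nd]] := choice evF.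
pose f u := (del (n u) * ev (d u) - ev (n u) * del (d u)) / ev (d u) ^+ 2.
have fE a b : ev b != 0 ->
    f (ev a / ev b) = (del a * ev b - ev a * del b) / ev b ^+ 2.
  move=> nb; have [nd' e] := nd (ev a / ev b).
  by apply: cross => //; rewrite -e.
exists f; split=> [u v|u v|a].
- have [a [b [nb ->]]] := evF u; have [c [e [ne ->]]] := evF v.
  have -> : ev a / ev b + ev c / ev e = ev (a * e + c * b) / ev (b * e).
    by rewrite rmorphD !rmorphM; field; rewrite nb ne.
  rewrite !fE ?rmorphM ?mulf_neq0 //.
  rewrite delD !delM  rmorphD !rmorphM; field.
  by rewrite nb ne.
- have [a [b [nb ->]]] := evF u; have [c [e [ne ->]]] := evF v.
  have -> : ev a / ev b * (ev c / ev e) = ev (a * c) / ev (b * e).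
    by rewrite !rmorphM mulf_div.
  rewrite !fE ?rmorphM ?mulf_neq0 //.
  rewrite !delM  ; field.
  by rewrite nb ne.
- have := fE a 1; rewrite !rmorph1 !divr1 oner_neq0 => -> //.
  have := delM 1 1; rewrite mulr1 rmorph1 !mul1r.
  move/eqP; rewrite -subr_eq0 opprD addNKr oppr_eq0 => /eqP ->.
  by rewrite mulr0 subr0 mulr1 expr1n divr1.
Qed.
End FractionFactor.

Definition pev (k F : fieldType) (e : {rmorphism k -> F}) (t : F) (p : {poly k}) : F :=
  (map_poly e p).[t].
Arguments pev : simpl never.

Definition transcendental (k F : fieldType) (e : {rmorphism k -> F}) (t : F) :=
  forall p, pev e t p = 0 -> p = 0.

Section PolynomialEvaluation.
Variables (k F : fieldType) (e : {rmorphism k -> F}).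

Fact pev_is_zmod_morphism t : zmod_morphism (pev e t).
Proof. exact: (raddfB (horner_eval t \o map_poly e)). Qed.
HB.instance Definition _ t :=
  GRing.isZmodMorphism.Build {poly k} F (pev e t) (pev_is_zmod_morphism t).

Fact pev_is_monoid_morphism t : monoid_morphism (pev e t).
Proof.
split=> [|p q]; first exact: (rmorph1 (horner_eval t \o map_poly e)).
exact: (rmorphM (horner_eval t \o map_poly e)).
Qed.
HB.instance Definition _ t :=
  GRing.isMonoidMorphism.Build {poly k} F (pev e t) (pev_is_monoid_morphism t).

Lemma pevE t p : pev e t p = (map_poly e p).[t]. Proof. by []. Qed.

Lemma pevC t a : pev e t a%:P = e a.
Proof. by rewrite pevE map_polyC hornerC. Qed.

Lemma pevX t : pev e t 'X = t.
Proof. by rewrite pevE map_polyX hornerX. Qed.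

Lemma pev_sum t p : pev e t p = \sum_(i < size p) e p`_i * t ^+ i.
Proof. by rewrite pevE horner_coef size_map_poly; under eq_bigr do rewrite coef_map. Qed.
End PolynomialEvaluation.

Lemma rmorph_pev (k F G : fieldType) (e : {rmorphism k -> F})
    (f : {rmorphism F -> G}) t p : f (pev e t p) = pev (f \o e) (f t) p.
Proof. by rewrite !pevE -horner_map /= -map_poly_comp. Qed.

Lemma eq_pev (k F : fieldType) (e e' : {rmorphism k -> F}) t p :
  e =1 e' -> pev e t p = pev e' t p.
Proof. by move=> ee'; rewrite !pevE (eq_map_poly ee'). Qed.

Lemma derivation_extend (K L : fieldType) (i : {rmorphism K -> L}) (y : L)
    (M : {poly K}) (D0 : K -> K) :
  (forall u, exists P, u = pev i y P) -> pev i y M = 0 -> pev i y M^`() != 0 ->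
  (forall P, pev i y P = 0 -> M %| P) ->
  (forall u v, D0 (u + v) = D0 u + D0 v) ->
  (forall u v, D0 (u * v) = u * D0 v + v * D0 u) ->
  exists D : L -> L, [/\ forall u v, D (u + v) = D u + D v,
    forall u v, D (u * v) = u * D v + v * D u & forall a, D (i a) = i (D0 a)].
Proof.
move=> ygen My dMy Mmin D0D D0M.
have D00 : D0 0 = 0.
  by have /eqP := D0D 0 0; rewrite addr0 -subr_eq0 opprD addNKr oppr_eq0 => /eqP.
have cD P j : (map_poly D0 P)`_j = D0 P`_j by rewrite coef_map_id0.
pose dc P := pev i y (map_poly D0 P).
have dcD P Q : dc (P + Q) = dc P + dc Q.
  rewrite /dc -rmorphD; congr (pev i y _); apply/polyP => j.
  by rewrite coefD !cD coefD D0D.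
have dcM P Q : dc (P * Q) = pev i y P * dc Q + pev i y Q * dc P.
  rewrite /dc -!rmorphM -rmorphD; congr (pev i y _); apply/polyP => j.
  rewrite coefD cD coefM (big_morph D0 D0D D00) coefM [(Q * _)`_j]coefMr -big_split.
  by apply: eq_bigr => l _; rewrite !cD D0M.
pose b := - dc M / pev i y M^`().
pose del P := dc P + pev i y P^`() * b.
have delD P Q : del (P + Q) = del P + del Q.
  by rewrite /del dcD derivD rmorphD; ring.
have delM P Q : del (P * Q) = pev i y P * del Q + pev i y Q * del P.
  by rewrite /del dcM derivM rmorphD !rmorphM; ring.
have del0 P : pev i y P = 0 -> del P = 0.
  move=> /Mmin /dvdpP[Q ->].
  have -> : del M = 0 -> del (Q * M) = 0 by move=> dM; rewrite delM dM My; ring.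
    by [].
  by rewrite /del /b; field.
have yfrac u : exists P Q, pev i y Q != 0 /\ u = pev i y P / pev i y Q.
  by have [P ->] := ygen u; exists P, 1; rewrite rmorph1 oner_neq0 divr1.
have [D [DD DM Ddel]] := derivation_factor yfrac delD delM del0.
exists D; split=> // a.
rewrite -(pevC i y) Ddel /del derivC raddf0 mul0r addr0 /dc -(pevC i y); congr (pev i y _).
by apply/polyP => j; rewrite cD !coefC; case: eqP.
Qed.

Section FunctionFieldDerivation.
Variables (k K : fieldType) (c : {rmorphism k -> K}) (x : K).
Hypothesis x_transc : transcendental c x.
Hypothesis x_gen : forall S : set K, divring_closed [in S] ->
  (forall a, S (c a)) -> S x -> forall u, S u.

Lemma rational_in y : (exists p q, pev c y q != 0 /\ x = pev c y p / pev c y q) ->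
  forall u, exists p q, pev c y q != 0 /\ u = pev c y p / pev c y q.
Proof.
move=> xy; apply: x_gen => [|a|//].
  split=> [|u v|u v]; rewrite !inE.
  - by exists 1, 1; rewrite rmorph1 oner_neq0 divr1.
  - move=> [p [q [nq ->]]] [r [s [ns ->]]]; exists (p * s - r * q), (q * s).
    rewrite rmorphB !rmorphM mulf_neq0 //; split=> //.
    by field; rewrite nq ns.
  - move=> [p [q [nq ->]]] [r [s [ns ->]]].
    have [->|nr] := eqVneq (pev c y r) 0.
      by exists 0, 1; rewrite rmorph0 rmorph1 oner_neq0 mul0r invr0 mulr0 mul0r.
    exists (p * s), (q * r).
    rewrite !rmorphM mulf_neq0 //; split=> //.
    by field; rewrite nq ns nr.
by exists a%:P, 1; rewrite pevC rmorph1 oner_neq0 divr1.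
Qed.

Lemma rational_x u : exists p q, pev c x q != 0 /\ u = pev c x p / pev c x q.
Proof.
by apply: rational_in; exists 'X, 1; rewrite pevX rmorph1 oner_neq0 divr1.
Qed.

Lemma base_derivation : exists D : K -> K, [/\ forall u v, D (u + v) = D u + D v,
  forall u v, D (u * v) = u * D v + v * D u, forall a, D (c a) = 0 & D x = 1].
Proof.
have [|||D [DD DM Dp]] := @derivation_factor _ _ _ rational_x (fun p => pev c x p^`()).
- by move=> p q; rewrite derivD rmorphD.
- by move=> p q; rewrite derivM rmorphD !rmorphM; ring.
- by move=> p /x_transc ->; rewrite linear0 rmorph0.
exists D; split=> // [a|]; first by rewrite -(pevC c x) Dp derivC rmorph0.
by rewrite -[X in D X](pevX c x) Dp derivX rmorph1.
Qed.

Variable L : splittingFieldType K.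
Hypothesis galL : galois 1 {:L}.

Lemma function_field_derivation :
  exists D : L -> L, [/\ forall u v, D (u + v) = D u + D v,
    forall u v, D (u * v) = u * D v + v * D u, forall a, D (c a)%:A = 0
  & D x%:A = 1].
Proof.
have [D0 [D0D D0M D0c D0x]] := base_derivation.
have /and3P[_ sepL _] := galL.
have sE := eq_adjoin_separable_generator sepL (sub1v _).
set y := separable_generator _ _ in sE.
have [M Mmin] : exists M : {poly K}, minPoly 1 y = map_poly (in_alg L) M.
  by apply/polyOver1P; exact: minPolyOver.
have [||||D [DD DM DK]] := @derivation_extend K L (in_alg L) y M D0 _ _ _ _ D0D D0M.
- move=> u; have : u \in <<1; y>>%VS by rewrite -sE memvf.
  move=> /Fadjoin_polyP[p /polyOver1P[P ->] ->]; by exists P.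
- by rewrite pevE -Mmin minPolyxx.
- rewrite pevE -deriv_map -Mmin.
  have := separable_generatorP {:L}%AS 1%AS; rewrite -/y => sepy.
  by have := separable_root_der 1%AS y; rewrite sepy /= => /rootP/eqP.
- move=> P; rewrite pevE => Py; rewrite -(dvdp_map (in_alg L)) -Mmin.
  apply: minPoly_dvdp; last exact/rootP.
  by apply/polyOver1P; exists P.
exists D; split=> // [a|]; first by rewrite -in_algE DK D0c rmorph0.
by rewrite -in_algE DK D0x rmorph1.
Qed.

End FunctionFieldDerivation.

Definition ev2 (k F : fieldType) (e : {rmorphism k -> F}) (t y : F) (P : {poly {poly k}}) : F :=
  (map_poly (pev e t) P).[y].
Arguments ev2 : simpl never.

Section BivariateEvaluation.
Variables (k F : fieldType) (e : {rmorphism k -> F}).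

Fact ev2_is_zmod_morphism t y : zmod_morphism (ev2 e t y).
Proof. exact: (raddfB (horner_eval y \o map_poly (pev e t))). Qed.
HB.instance Definition _ t y :=
  GRing.isZmodMorphism.Build {poly {poly k}} F (ev2 e t y) (ev2_is_zmod_morphism t y).

Fact ev2_is_monoid_morphism t y : monoid_morphism (ev2 e t y).
Proof.
split=> [|P Q]; first exact: (rmorph1 (horner_eval y \o map_poly (pev e t))).
exact: (rmorphM (horner_eval y \o map_poly (pev e t))).
Qed.
HB.instance Definition _ t y :=
  GRing.isMonoidMorphism.Build {poly {poly k}} F (ev2 e t y) (ev2_is_monoid_morphism t y).

Lemma ev2E t y P : ev2 e t y P = (map_poly (pev e t) P).[y]. Proof. by []. Qed.

Lemma ev2C t y p : ev2 e t y p%:P = pev e t p.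
Proof. by rewrite ev2E map_polyC hornerC. Qed.

Lemma ev2X t y : ev2 e t y 'X = y.
Proof. by rewrite ev2E map_polyX hornerX. Qed.

Lemma ev2_sum t y P : ev2 e t y P = \sum_(i < size P) pev e t P`_i * y ^+ i.
Proof.
rewrite ev2E (@horner_coef_wide _ (size P)) ?size_poly //.
by under eq_bigr do rewrite coef_map.
Qed.

Lemma ev2_swap t y P : ev2 e y t (swapXY P) = ev2 e t y P.
Proof.
have ev2h u v Q : ev2 e u v Q = (swapXY (map_poly (map_poly e) Q)).[u%:P].[v].
  by rewrite horner_swapXY -map_poly_comp.
by rewrite !ev2h -swapXY_map swapXYK horner2_swapXY.
Qed.

Lemma separable_relation t y P : [pchar k] =i pred0 ->
  transcendental e t -> P != 0 -> ev2 e t y P = 0 ->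
  exists Q, ev2 e t y Q = 0 /\ ev2 e t y Q^`() != 0.
Proof.
move=> /pcharf0P ch0 tt; elim/ltn_ind: (size P) {-2}P (erefl (size P)) => n IH {}P sP nP Py.
have [dP|dP] := eqVneq (ev2 e t y P^`()) 0; last by exists P.
have [dP0|dP0] := eqVneq P^`() 0; last first.
  have lt_n : (size P^`() < n)%N by rewrite -sP lt_size_deriv.
  exact: (IH _ lt_n _ erefl).
have s1 : (size P <= 1)%N.
  rewrite leqNgt; apply/negP => s2; have := congr1 (fun p : {poly {poly k}} => p`_(size P).-2) dP0.
  rewrite coef_deriv coef0 -subn2 -subSn // subn2 /= => /eqP.
  rewrite -mulr_natr mulf_eq0 -lead_coefE lead_coef_eq0 (negPf nP) /=.
  by rewrite -polyC_natr polyC_eq0 ch0; case: (size P) s2 => [|[]].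
move: Py nP; rewrite (size1_polyC s1) ev2C => /tt ->; by rewrite polyC0 eqxx.
Qed.
End BivariateEvaluation.

Lemma clear_denominators (A : comNzRingType) (F : fieldType)
    (ev : {rmorphism A -> F}) :
  (forall u, exists a b, ev b != 0 /\ u = ev a / ev b) ->
  forall p : {poly F}, exists P d, ev d != 0 /\ map_poly ev P = ev d *: p.
Proof.
move=> evF; elim/poly_ind => [|p u [P [d [nd dP]]]].
  by exists 0, 1; rewrite rmorph1 oner_neq0 map_poly0 scaler0.
have [a [b [nb ->]]] := evF u.
exists (b *: P * 'X + (a * d)%:P), (b * d).
rewrite rmorphM mulf_neq0 // rmorphD !rmorphM /= map_polyX map_polyZ dP map_polyC /=.
split=> //; rewrite scalerA scalerDr -scalerAl; congr (_ + _).
by rewrite map_polyC -mul_polyC -!polyCM /=; apply: congr1; field; rewrite nb.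
Qed.

Lemma fraction_repr (R : idomainType) (f : {fraction R}) :
  f = FracField.tofrac \n_(repr f) / FracField.tofrac \d_(repr f).
Proof.
have nd : FracField.tofrac \d_(repr f) != 0 by rewrite tofrac_eq0 denom_ratioP.
apply: (canRL (mulfK nd)); rewrite -{1}[f]reprK; apply/eqP.
rewrite piE FracField.equivfE /FracField.mulf !numden_Ratio ?mulf_neq0 ?oner_eq0 ?denom_ratioP //.
by rewrite !mulr1 mulrC.
Qed.

Lemma fraction_rational (k : fieldType) (f : ratfun k) :
  exists a b : {poly k}, FracField.tofrac b != 0 /\ f = FracField.tofrac a / FracField.tofrac b.
Proof.
exists \n_(repr f), \d_(repr f); rewrite tofrac_eq0 denom_ratioP.
by split=> //; exact: fraction_repr.
Qed.

Section AlgebraicRelation.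
Variables (k K : fieldType) (c : {rmorphism k -> K}) (x : K).
Hypothesis x_transc : transcendental c x.
Hypothesis x_rat : forall u, exists p q, pev c x q != 0 /\ u = pev c x p / pev c x q.
Variables (L : fieldExtType K) (e : {rmorphism k -> L}).
Hypothesis eE : forall a, e a = (c a)%:A.

Lemma pev_in_alg p : pev e x%:A p = (pev c x p)%:A.
Proof. by rewrite -!in_algE rmorph_pev; apply: eq_pev => a; rewrite eE. Qed.

Lemma relation_over_x u :
  exists2 P : {poly {poly k}}, P != 0 & (size P <= size (minPoly 1 u))%N /\ ev2 e x%:A u P = 0.
Proof.
have [M Mmin] : exists M : {poly K}, minPoly 1 u = map_poly (in_alg L) M.
  by apply/polyOver1P; exact: minPolyOver.
have [P [d [nd dP]]] := clear_denominators x_rat M.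
have e1 : map_poly (pev e x%:A) P = (pev c x d)%:A *: minPoly 1 u.
  have -> : (pev c x d)%:A *: minPoly 1 u = map_poly (in_alg L) (pev c x d *: M).
    by rewrite Mmin map_polyZ.
  rewrite -dP -map_poly_comp.
  by apply: eq_map_poly => p; rewrite pev_in_alg.
have nd' : (pev c x d)%:A != 0 :> L by rewrite -in_algE fmorph_eq0.
exists P.
  apply/eqP => P0; move/eqP: e1; rewrite P0 map_poly0 eq_sym scaler_eq0.
  by rewrite (negPf nd') (negPf (monic_neq0 (monic_minPoly _ _))).
split; last by rewrite ev2E e1 hornerZ minPolyxx mulr0.
rewrite -(size_scale (minPoly 1 u) nd') -e1 size_map_inj_poly ?rmorph0 //.
move=> p q /eqP; rewrite -subr_eq0 -rmorphB /= pev_in_alg -in_algE fmorph_eq0.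
by move=> /eqP/x_transc/eqP; rewrite subr_eq0 => /eqP.
Qed.

Lemma algebraic_over t u : transcendental e t -> exists2 P, P != 0 & ev2 e t u P = 0.
Proof.
move=> tt.
have [h hE] : exists h : {rmorphism ratfun k -> L},
    forall p, h (FracField.tofrac p) = pev e t p.
  apply: rmorphism_factor; first exact: fraction_rational.
  move=> p; rewrite tofrac_eq0.
  by apply/eqP/eqP => [/tt|->]; rewrite ?rmorph0.
have he a : integralOver h (e a) by rewrite -(pevC e t) -hE; exact: integral_id.
have hx : integralOver h x%:A.
  have [P nP [_ Px]] := relation_over_x t.
  apply/integral_algebraic; exists (map_poly (@FracField.tofrac {poly k}) (swapXY P)).
    by rewrite map_poly_eq0_id0 ?tofrac_eq0 ?lead_coef_eq0 swapXY_eq0.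
  rewrite -map_poly_comp; apply/rootP; rewrite -Px -ev2_swap ev2E.
  by congr (_.[_]); apply: eq_map_poly => p /=; rewrite hE.
have hpx p : integralOver h (pev e x%:A p).
  rewrite pevE; apply: integral_horner => //; apply/integral_poly => i.
  by rewrite coef_map; exact: he.
have hK a : integralOver h a%:A.
  have [p [q [nq ->]]] := x_rat a.
  have -> : (pev c x p / pev c x q)%:A = pev e x%:A p / pev e x%:A q.
    by rewrite !pev_in_alg; exact: (fmorph_div (in_alg L)).
  exact: integral_div.
have [P nP Pu] : algebraicOver h u.
  apply/integral_algebraic.
  apply: (integral_root_monic (monic_minPoly 1 u)); first by rewrite root_minPoly.
  apply/integral_poly => i; have /polyOverP/(_ i) := minPolyOver 1 u.
  by case/vlineP => a ->; exact: hK.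
have [Q [d [nd dQ]]] := clear_denominators (@fraction_rational k) P.
exists Q.
  apply/eqP => Q0; move/eqP: dQ; rewrite Q0 map_poly0 eq_sym scaler_eq0 (negPf nd).
  by rewrite (negPf nP).
rewrite ev2E; have -> : map_poly (pev e t) Q = map_poly h (map_poly (@FracField.tofrac _) Q).
  by rewrite -map_poly_comp; apply: eq_map_poly => p /=; rewrite hE.
by rewrite dQ map_polyZ hornerZ (rootP Pu) mulr0.
Qed.
End AlgebraicRelation.

(** * Derivations and Kaehler differentials *)

Section DerivationAlong.
Variables (k L M : fieldType) (e : {rmorphism k -> L}) (f : {rmorphism L -> M}).
Variables (V : lmodType M) (d : L -> V).
Hypothesis dD : forall a b, d (a + b) = d a + d b.
Hypothesis dM : forall a b, d (a * b) = f a *: d b + f b *: d a.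
Hypothesis dC : forall a, d (e a) = 0.

Lemma derivation_pev t p : d (pev e t p) = f (pev e t p^`()) *: d t.
Proof.
have d0 : d 0 = 0 by rewrite -(rmorph0 e) dC.
elim/poly_ind: p => [|p a IH]; first by rewrite linear0 !rmorph0 scale0r.
rewrite derivMXaddC !rmorphD !rmorphM /= !pevX !pevC dD dM dC addr0 IH.
by rewrite scalerDl scalerA [f t * _]mulrC.
Qed.

Lemma derivation_ev2 t y P :
  d (ev2 e t y P) = f (ev2 e t y (map_poly deriv P)) *: d t + f (ev2 e t y P^`()) *: d y.
Proof.
have d0 : d 0 = 0 by rewrite -(rmorph0 e) dC.
elim/poly_ind: P => [|P p IH].
  by rewrite linear0 map_poly0 !rmorph0 !scale0r d0 addr0.
have -> : map_poly deriv (P * 'X + p%:P) = map_poly deriv P * 'X + p^`()%:P.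
  apply/polyP => i; rewrite coefD coefMX !coef_map_id0 ?linear0 // coefD coefMX !coefC linearD.
  by case: i => [|i] //=; rewrite ?linear0 // coef_map_id0 ?linear0.
rewrite derivMXaddC !rmorphD !rmorphM /= !ev2X !ev2C dD dM IH derivation_pev.
rewrite !scalerDl !scalerDr !scalerA ![f y * _]mulrC.
by rewrite (AC (1*2*1) ((2*4)*(1*3))).
Qed.

Lemma derivation_unique t : d t = 0 ->
  (forall u, exists P, ev2 e t u P = 0 /\ ev2 e t u P^`() != 0) -> forall u, d u = 0.
Proof.
move=> dt rel u; have [P [Pu dPu]] := rel u.
have := derivation_ev2 t u P; rewrite Pu dt scaler0 add0r -(rmorph0 e) dC => /esym/eqP.
by rewrite scaler_eq0 fmorph_eq0 (negPf dPu) => /eqP.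
Qed.
End DerivationAlong.

Lemma kaehler_regular (k L : fieldType) (e : {rmorphism k -> L}) (x : L) (D : L -> L) :
  (forall u, exists P, ev2 e x u P = 0 /\ ev2 e x u P^`() != 0) ->
  (forall u v, D (u + v) = D u + D v) ->
  (forall u v, D (u * v) = u * D v + v * D u) -> (forall a, D (e a) = 0) ->
  D x = 1 -> kaehler e (D : L -> L^o).
Proof.
move=> rel DD DM DC Dx; split=> [|V dl [dlD dlM dlC]]; first by split.
pose h (u : L^o) : V := (u : L) *: dl x.
have hlin : linear h by move=> a u v; rewrite /h scalerDl scalerA.
pose hl := GRing.isLinear.Build L L^o V *:%R h hlin.
pose hL : {linear L^o -> V} := HB.pack h hl.
have hE a : hL (D a) = dl a.
  apply/eqP; rewrite -subr_eq0; apply/eqP; move: a.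
  apply: (@derivation_unique _ _ _ e idfun _ _ _ _ _ x) => //= [a b|a b|a|] /=.
  - by rewrite /h DD dlD scalerDl opprD addrACA.
  - by rewrite /h DM dlM scalerDl -!scalerA !scalerBr opprD addrACA.
  - by rewrite /h DC dlC scale0r subr0.
  - by rewrite /h Dx scale1r subrr.
exists hL => // psi psiE a.
have -> : a = a *: (D x : L^o) by rewrite Dx; rewrite /GRing.scale /= mulr1.
by rewrite !linearZ psiE hE.
Qed.

(** * Valuations and places *)

Definition valuation (k L : fieldType) (e : {rmorphism k -> L}) (v : L -> int) :=
  [/\ forall x y, x != 0 -> y != 0 -> v (x * y) = v x + v y,
      forall x y, x != 0 -> y != 0 -> x + y != 0 -> Num.min (v x) (v y) <= v (x + y)
    & forall c, c != 0 -> v (e c) = 0].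

(* The value of a valuation at 0 is junk, hence the first disjunct. *)
Definition vge (L : fieldType) (v : L -> int) (n : int) (y : L) :=
  (y == 0) || (n <= v y).

Section Valuation.
Variables (k L : fieldType) (e : {rmorphism k -> L}) (v : L -> int).
Hypothesis val_v : valuation e v.

Lemma valuationM y z : y != 0 -> z != 0 -> v (y * z) = v y + v z.
Proof. by have [vM _ _] := val_v; exact: vM. Qed.

Lemma valuationC a : a != 0 -> v (e a) = 0.
Proof. by have [_ _ vC] := val_v; exact: vC. Qed.

Lemma valuation1 : v 1 = 0.
Proof. by rewrite -(rmorph1 e) valuationC ?oner_neq0. Qed.

Lemma valuationN y : v (- y) = v y.
Proof.
have [->|ny] := eqVneq y 0; first by rewrite oppr0.
rewrite -mulN1r valuationM ?oppr_eq0 ?oner_neq0 // -(rmorphN1 e).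
by rewrite valuationC ?oppr_eq0 ?oner_neq0 // add0r.
Qed.

Lemma valuationV y : y != 0 -> v y^-1 = - v y.
Proof.
move=> ny; apply/eqP; rewrite -addr_eq0 -valuationM ?invr_eq0 //.
by rewrite mulVf // valuation1.
Qed.

Lemma valuationX y n : y != 0 -> v (y ^+ n) = v y * n%:Z.
Proof.
move=> ny; elim: n => [|n IH]; first by rewrite expr0 valuation1 mulr0.
by rewrite exprS valuationM ?expf_neq0 // IH; lia.
Qed.

Lemma vge0 n : vge v n 0.
Proof. by rewrite /vge eqxx. Qed.

Lemma vge_val n y : n <= v y -> vge v n y.
Proof. by rewrite /vge orbC => ->. Qed.

Lemma vgeE n y : y != 0 -> vge v n y = (n <= v y).
Proof. by rewrite /vge => /negPf ->. Qed.

Lemma vgeW m n y : m <= n -> vge v n y -> vge v m y.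
Proof. by rewrite /vge => mn /orP[->//|/(le_trans mn) ->]; rewrite orbT. Qed.

Lemma vgeN n y : vge v n (- y) = vge v n y.
Proof. by rewrite /vge oppr_eq0 valuationN. Qed.

Lemma vgeD n y z : vge v n y -> vge v n z -> vge v n (y + z).
Proof.
have [->|ny] := eqVneq y 0; first by rewrite add0r.
have [->|nz] := eqVneq z 0; first by rewrite addr0.
have [yz0|nyz] := eqVneq (y + z) 0; first by rewrite yz0 vge0.
rewrite !vgeE // => vy vz; have [_ vA _] := val_v.
by apply: le_trans (vA _ _ ny nz nyz); rewrite le_min vy vz.
Qed.

Lemma vgeB n y z : vge v n y -> vge v n z -> vge v n (y - z).
Proof. by move=> ny nz; apply: vgeD; rewrite ?vgeN. Qed.

Lemma vgeM m n y z : vge v m y -> vge v n z -> vge v (m + n) (y * z).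
Proof.
have [->|ny] := eqVneq y 0; first by rewrite mul0r !vge0.
have [->|nz] := eqVneq z 0; first by rewrite mulr0 !vge0.
by rewrite !vgeE ?mulf_neq0 // valuationM // => vy vz; lia.
Qed.

Lemma vgeC a : vge v 0 (e a).
Proof.
have [->|na] := eqVneq a 0; first by rewrite rmorph0 vge0.
by rewrite vgeE ?fmorph_eq0 // valuationC.
Qed.

Lemma vge1 : vge v 0 1. Proof. by rewrite -(rmorph1 e) vgeC. Qed.

Lemma vgeX m y n : vge v m y -> vge v (m * n%:Z) (y ^+ n).
Proof.
move=> vy; elim: n => [|n IH]; first by rewrite mulr0 expr0 vge1.
by rewrite exprS; apply: vgeW (vgeM vy IH); lia.
Qed.

Lemma vge_sum n (I : Type) (r : seq I) (P : pred I) (F : I -> L) :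
  (forall i, P i -> vge v n (F i)) -> vge v n (\sum_(i <- r | P i) F i).
Proof. by move=> vF; elim/big_ind: _ => //; [exact: vge0|exact: vgeD]. Qed.

Lemma val_dominant y z : y != 0 -> vge v (v y + 1) z -> y + z != 0 /\ v (y + z) = v y.
Proof.
move=> ny vz; have nyz : y + z != 0.
  by apply/eqP => /eqP; rewrite addr_eq0 => /eqP e1; move: vz; rewrite -vgeN -e1 vgeE //; lia.
split=> //; apply/eqP; rewrite eq_le -[X in _ && X]vgeE //; apply/andP; split; last first.
  by apply: vgeD; [rewrite vgeE|apply: vgeW vz; lia].
rewrite leNgt; apply/negP => vyz.
have : vge v (v y + 1) (y + z - z) by apply: vgeB => //; rewrite vgeE //; lia.
by rewrite addrK vgeE //; lia.
Qed.

Lemma vge_pev t p : vge v 0 t -> vge v 0 (pev e t p).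
Proof.
move=> vt; rewrite pev_sum; apply: vge_sum => i _.
by apply: vgeW (vgeM (vgeC _) (vgeX _ vt)); lia.
Qed.

Lemma vge_pev_root0 t n (p : {poly k}) : 0 <= n -> vge v n t -> p`_0 = 0 -> vge v n (pev e t p).
Proof.
move=> n0 vt p0; rewrite pev_sum; apply: vge_sum => -[[|i] lti] _ /=.
  by rewrite p0 rmorph0 mul0r vge0.
apply: vgeW (vgeM (vgeC _) (vgeX _ vt)); nia.
Qed.

Lemma val_pev t (p : {poly k}) : vge v 1 t -> p`_0 != 0 -> pev e t p != 0 /\ v (pev e t p) = 0.
Proof.
move=> vt p0.
have -> : pev e t p = e p`_0 + pev e t (p - (p`_0)%:P) by rewrite rmorphB /= !pevC; ring.
have := @val_dominant (e p`_0) (pev e t (p - (p`_0)%:P)).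
rewrite valuationC // fmorph_eq0; apply=> //.
by apply: vge_pev_root0; rewrite ?coefB ?coefC ?subrr.
Qed.

End Valuation.

Lemma poly_X_factor (R : idomainType) (p : {poly R}) : p != 0 ->
  exists n (q : {poly R}), q`_0 != 0 /\ p = q * 'X^n.
Proof.
move=> np; have [n [q nq ->]] := multiplicity_XsubC p 0.
by exists n, q; rewrite np /= /root horner_coef0 subr0 in nq *.
Qed.

Lemma valuation_trivial (k L : fieldType) (e : {rmorphism k -> L}) (v : L -> int) y s
    (P : {poly {poly k}}) :
  valuation e v -> (forall p, p != 0 -> pev e y p != 0 /\ v (pev e y p) = 0) ->
  P != 0 -> ev2 e y s P = 0 -> s != 0 -> ~~ (0 < v s).
Proof.
move=> val_v py nP Ps ns; apply/negP => vs.
have [n [Q [nQ0 PE]]] : exists n (Q : {poly {poly k}}), Q`_0 != 0 /\ P = Q * 'X^n.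
  exact: poly_X_factor.
have {PE Ps}Qs : ev2 e y s Q = 0.
  move/eqP: Ps; rewrite PE rmorphM rmorphXn /= ev2X mulf_eq0 expf_eq0 (negPf ns) andbF orbF.
  by move=> /eqP.
have [nq vq] := py _ nQ0.
have [||nz _] := val_dominant val_v (y := pev e y Q`_0) (z := ev2 e y s (Q - (Q`_0)%:P)).
- exact: nq.
- rewrite vq add0r ev2_sum; apply: (vge_sum val_v) => -[[|i] lti] _ /=.
    by rewrite coefB coefC subrr rmorph0 mul0r vge0.
  have vpy p : vge v 0 (pev e y p).
    have [->|np] := eqVneq p 0; first by rewrite rmorph0 vge0.
    by have [np0 vp] := py _ np; rewrite vgeE // vp.
  apply: vgeW (vgeM val_v (vpy _) (vgeX val_v _ (vge_val (lexx (v s))))); nia.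
- move/eqP: nz; apply.
  have := rmorphD (ev2 e y s) (Q`_0)%:P (Q - (Q`_0)%:P).
  rewrite [(Q`_0)%:P + _]addrC subrK /=.
  by rewrite Qs ev2C => /esym.
Qed.

Lemma valuation_normalize (k L : fieldType) (e : {rmorphism k -> L}) (V : L -> int) y :
  valuation e V -> y != 0 -> V y != 0 ->
  exists v g, [/\ place e v, 0 < g & forall u, u != 0 -> V u = g * v u].
Proof.
move=> val_V ny nVy.
pose Q n := `[< exists2 u, u != 0 & V u = n.+1%:Z >].
have [n Qn] : exists n, Q n.
  exists `|V y|.-1; apply/asboolP.
  case: (lerP 0 (V y)) => [V0|V0]; first by exists y => //; lia.
  by exists y^-1; rewrite ?invr_eq0 // (valuationV val_V) //; lia.
case: (ex_minnP (ex_intro _ n Qn)) => {n Qn} n /asboolP[t nt Vt] nmin.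
pose g : int := n.+1%:Z; have g0 : g != 0 by []; have g_gt0 : 0 < g by [].
have dvd u : u != 0 -> V u = g * (V u %/ g)%Z.
  move=> nu; set q := (V u %/ g)%Z.
  have [m m0 tE] : exists2 m : int, 0 <= m & V u = q * g + m /\ m < g.
    exists (V u %% g)%Z; first exact: modz_ge0.
    by split; [exact: divz_eq|have := @ltz_pmod (V u) g; apply].
  case: tE => VE mg.
  have [tq [ntq Vtq]] : exists tq, tq != 0 /\ V tq = - q * g.
    case: (lerP 0 q) => q0.
      exists (t^-1 ^+ `|q|); rewrite expf_neq0 ?invr_eq0 //.
      by rewrite (valuationX val_V) ?invr_eq0 // (valuationV val_V) // Vt /g; split=> //; nia.
    exists (t ^+ `|q|); rewrite expf_neq0 //.
    by rewrite (valuationX val_V) // Vt /g; split=> //; nia.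
  have Vutq : V (u * tq) = m by rewrite (valuationM val_V) // Vtq VE; lia.
  have [m00|nm0] := eqVneq m 0; first by rewrite VE m00; lia.
  have : Q `|m|.-1 by apply/asboolP; exists (u * tq); rewrite ?mulf_neq0 // Vutq; lia.
  by move/nmin; lia.
exists (fun u => (V u %/ g)%Z), g; split=> //.
have [VM VA VC] := val_V.
split=> [a b na nb|a b na nb nab|a na|].
- by apply: (mulfI g0); rewrite mulrDr -!dvd ?mulf_neq0 // VM.
- by have := VA _ _ na nb nab; rewrite !ge_min => /orP[H|H]; apply/orP; [left|right];
    rewrite -(ler_pM2l g_gt0) -!dvd.
- by rewrite VC // div0z.
- by exists t; rewrite // Vt divzz.
Qed.

Lemma closed_transcendental (k : closedFieldType) (L : fieldType) (e : {rmorphism k -> L}) y :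
  (forall a, y != e a) -> transcendental e y.
Proof.
move=> ny p; elim/ltn_ind: (size p) {-2}p (erefl (size p)) => n IH {}p sp py.
have [p1|np1] := eqVneq (size p) 1.
  move: py; rewrite (size1_polyC (eq_leq p1)) pevC => /eqP.
  by rewrite fmorph_eq0 => /eqP ->.
have [a /factor_theorem[q pE]] := closed_rootP p np1.
have [p0|np] := eqVneq p 0; first exact: p0.
have nq : q != 0 by apply: contraNneq np => q0; rewrite pE q0 mul0r.
have qy : pev e y q = 0.
  move/eqP: py; rewrite pE rmorphM rmorphB /= pevX pevC mulf_eq0 subr_eq0 (negPf (ny a)) orbF.
  by move/eqP.
have sq : (size q < n)%N by rewrite -sp pE size_Mmonic ?monicXsubC // size_XsubC addn2.
by rewrite pE (IH _ sq _ erefl qy) mul0r.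
Qed.

Section ClosedPlaces.
Variables (k : closedFieldType) (L : fieldType) (e : {rmorphism k -> L}).
Hypothesis char0 : [pchar k] =i pred0.
Hypothesis algL : forall t u, transcendental e t -> exists2 P, P != 0 & ev2 e t u P = 0.

Lemma place_valuation v : place e v -> valuation e v.
Proof. by case. Qed.

Lemma place_nontrivial v y : place e v ->
  exists2 p, p != 0 & pev e y p = 0 \/ v (pev e y p) != 0.
Proof.
move=> pl; have val_v := place_valuation pl.
have [_ _ _ [s ns vs]] := pl.
apply: contrapT => H.
have py p : p != 0 -> pev e y p != 0 /\ v (pev e y p) = 0.
  move=> np; split; first by apply/eqP => py; apply: H; exists p => //; left.
  by apply/eqP; apply: contrapT => /negP vp; apply: H; exists p => //; right.
have ty : transcendental e y.
  by move=> p py0; apply/eqP; apply: contraT => /py[]; rewrite py0 eqxx.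
have [P nP Ps] := algL s ty.
by have := valuation_trivial val_v py nP Ps ns; rewrite vs.
Qed.

Lemma place_residue v y : place e v -> vge v 0 y -> exists a, vge v 1 (y - e a).
Proof.
move=> pl vy; have val_v := place_valuation pl.
apply: contrapT => H.
have ya a : y - e a != 0 /\ v (y - e a) = 0.
  have va : vge v 0 (y - e a) by apply: (vgeB val_v) => //; exact: vgeC.
  have nva : ~~ vge v 1 (y - e a) by apply/negP => ?; apply: H; exists a.
  have nya : y - e a != 0 by apply: contraNneq nva => ->; exact: vge0.
  by split=> //; move: va nva; rewrite !vgeE //; lia.
have [p np] := place_nontrivial y pl; apply/not_orP; rewrite -/(~ _).
have : pev e y p != 0 /\ v (pev e y p) = 0.
  move: {2}(size p) (erefl (size p)) => n; elim/ltn_ind: n p np => n IH p np sp.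
  have [p1|np1] := eqVneq (size p) 1.
    rewrite (size1_polyC (eq_leq p1)) pevC fmorph_eq0.
    have np0 : p`_0 != 0 by move: np; rewrite {1}(size1_polyC (eq_leq p1)) polyC_eq0.
    by rewrite (valuationC val_v).
  have [a /factor_theorem[q pE]] := closed_rootP p np1.
  have nq : q != 0 by apply: contraNneq np => q0; rewrite pE q0 mul0r.
  have sq : (size q < n)%N by rewrite -sp pE size_Mmonic ?monicXsubC // size_XsubC addn2.
  have [nqy vqy] := IH _ sq _ nq erefl; have [nya vya] := ya a.
  rewrite pE rmorphM rmorphB /= pevX pevC mulf_neq0 //.
  by rewrite (valuationM val_v) // vqy vya.
by case=> np1 vp1; split; [apply/eqP|rewrite vp1 eqxx].
Qed.

Lemma place_expansion v t y n : place e v -> t != 0 -> v t = 1 -> vge v 0 y ->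
  exists p, vge v n%:Z (y - pev e t p).
Proof.
move=> pl nt vt vy; have val_v := place_valuation pl.
elim: n => [|n [p vp]]; first by exists 0; rewrite (rmorph0 (pev e t)) subr0.
have vr : vge v 0 ((y - pev e t p) * t^-1 ^+ n).
  apply: vgeW (vgeM val_v vp (vgeX val_v n (vge_val (lexx (v t^-1))))).
  by rewrite (valuationV val_v) // vt; lia.
have [a va] := place_residue pl vr; exists (p + a%:P * 'X^n).
rewrite rmorphD rmorphM rmorphXn /= pevC pevX.
have -> : y - (pev e t p + e a * t ^+ n) = ((y - pev e t p) * t^-1 ^+ n - e a) * t ^+ n.
  by rewrite mulrBl -mulrA -exprMn mulVf // expr1n; ring.
by apply: vgeW (vgeM val_v va (vgeX val_v n (vge_val (lexx (v t))))); rewrite vt; lia.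
Qed.

Lemma place_transcendental v t : place e v -> t != 0 -> v t = 1 -> transcendental e t.
Proof.
move=> pl nt vt p pt; have val_v := place_valuation pl; apply/eqP; apply: contraT => np.
have [n [q [q0 pE]]] := poly_X_factor np.
have vt1 : vge v 1 t by rewrite vgeE // vt.
have [nqt _] := val_pev val_v vt1 q0.
move/eqP: pt; rewrite pE rmorphM rmorphXn /= pevX mulf_eq0 expf_eq0 (negPf nt) andbF orbF.
by rewrite (negPf nqt).
Qed.

Lemma vge_pev_deriv v t p n : place e v -> t != 0 -> v t = 1 ->
  vge v n (pev e t p) -> vge v (n - 1) (pev e t p^`()).
Proof.
move=> pl nt vt vp; have val_v := place_valuation pl.
have [->|np] := eqVneq p 0; first by rewrite linear0 rmorph0 vge0.
have [m [q [q0 pE]]] := poly_X_factor np.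
have vt1 : vge v 1 t by rewrite vgeE // vt.
have vt0 : vge v 0 t by rewrite vgeE // vt.
have [nqt vqt] := val_pev val_v vt1 q0.
have nm : n <= m%:Z.
  move: vp; rewrite pE rmorphM rmorphXn /= pevX vgeE ?mulf_neq0 ?expf_neq0 //.
  by rewrite (valuationM val_v) ?expf_neq0 // vqt (valuationX val_v) // vt; lia.
rewrite pE derivM derivXn rmorphD !rmorphM rmorphMn !rmorphXn /= pevX.
have vX (j : nat) : vge v j%:Z (t ^+ j).
  by rewrite vgeE ?expf_neq0 // (valuationX val_v) // vt; lia.
apply: (vgeD val_v).
  by apply: vgeW (vgeM val_v (vge_pev val_v _ vt0) (vX _)); lia.
rewrite -mulr_natr mulrA -(rmorph_nat e).
apply: vgeW (vgeM val_v (vgeM val_v (vge_pev val_v _ vt0) (vX _)) (vgeC val_v _)); lia.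
Qed.

Lemma vge_ev2_congr v t y z n P : place e v -> vge v 0 t -> vge v 0 y -> vge v 0 z ->
  0 <= n -> vge v n (y - z) -> vge v n (ev2 e t y P - ev2 e t z P) /\ vge v 0 (ev2 e t y P).
Proof.
move=> pl vt vy vz n0 vyz; have val_v := place_valuation pl.
elim/poly_ind: P => [|P p [IH1 IH2]]; first by rewrite !rmorph0 subr0 !vge0.
rewrite !rmorphD !rmorphM /= !ev2X !ev2C; split.
  have -> : ev2 e t y P * y + pev e t p - (ev2 e t z P * z + pev e t p) =
    ev2 e t y P * (y - z) + (ev2 e t y P - ev2 e t z P) * z by ring.
  apply: (vgeD val_v); first by apply: vgeW (vgeM val_v IH2 vyz); lia.
  by apply: vgeW (vgeM val_v IH1 vz); lia.
apply: (vgeD val_v); last exact: vge_pev.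
by apply: vgeW (vgeM val_v IH2 vy); lia.
Qed.

Variables (x : L) (D : L -> L).
Hypothesis DD : forall u v, D (u + v) = D u + D v.
Hypothesis DM : forall u v, D (u * v) = u * D v + v * D u.
Hypothesis DC : forall a, D (e a) = 0.
Hypothesis Dx : D x = 1.

Lemma D_pev t p : D (pev e t p) = pev e t p^`() * D t.
Proof. exact: (@derivation_pev _ _ _ e idfun L^o D DD DM DC). Qed.

Lemma D_ev2 t y P : D (ev2 e t y P) = ev2 e t y (map_poly deriv P) * D t + ev2 e t y P^`() * D y.
Proof. exact: (@derivation_ev2 _ _ _ e idfun L^o D DD DM DC). Qed.

Lemma D_neq0 t : transcendental e t -> D t != 0.
Proof.
move=> tt; have [P nP Px] := algL x tt; have [Q [Qx dQ]] := separable_relation char0 tt nP Px.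
apply/eqP => Dt0; have := D_ev2 t x Q.
rewrite Qx Dt0 mulr0 add0r Dx mulr1 -(rmorph0 e) DC => /esym/eqP.
by rewrite (negPf dQ).
Qed.

(* Differentiating the polynomial relation between t and y at a long enough
   t-adic truncation of y computes D y / D t up to a regular function. *)
Lemma place_regular v t y : place e v -> t != 0 -> v t = 1 -> vge v 0 y ->
  exists2 u, D y = u * D t & vge v 0 u.
Proof.
move=> pl nt vt vy; have val_v := place_valuation pl.
have tt := place_transcendental pl nt vt; have nDt := D_neq0 tt.
have [P nP Py] := algL y tt; have [{nP}Q [Qy dQ]] := separable_relation char0 tt nP Py.
set s := ev2 e t y Q^`() in dQ.
pose n : nat := `|v s|.+1.
have [p vp] := place_expansion n pl nt vt vy.
have vt0 : vge v 0 t by rewrite vgeE // vt.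
set z := pev e t p in vp; have vz : vge v 0 z by exact: vge_pev.
have cong R : vge v n%:Z (ev2 e t y R - ev2 e t z R).
  by have [] := @vge_ev2_congr v t y z n%:Z R pl vt0 vy vz isT vp.
have ev2z R : ev2 e t z R = pev e t R.[p] by rewrite ev2E /z horner_map.
have vQz : vge v n%:Z (pev e t Q.[p]).
  by have := cong Q; rewrite Qy sub0r (vgeN val_v) ev2z.
have := vge_pev_deriv pl nt vt vQz.
have -> : pev e t Q.[p]^`() = ev2 e t z (map_poly deriv Q) + ev2 e t z Q^`() * pev e t p^`().
  apply: (mulIf nDt); rewrite -D_pev -ev2z D_ev2 D_pev; ring.
move=> vz1; have vp' : vge v 0 (pev e t p^`()) by exact: vge_pev.
have vy1 : vge v (n%:Z - 1) (ev2 e t y (map_poly deriv Q) + s * pev e t p^`()).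
  have -> : ev2 e t y (map_poly deriv Q) + s * pev e t p^`() = 
    (ev2 e t z (map_poly deriv Q) + ev2 e t z Q^`() * pev e t p^`()) +
    ((ev2 e t y (map_poly deriv Q) - ev2 e t z (map_poly deriv Q)) +
     (s - ev2 e t z Q^`()) * pev e t p^`()) by ring.
  apply: (vgeD val_v vz1); apply: (vgeD val_v).
    by apply: vgeW (cong _); rewrite gerBl.
  by apply: vgeW (vgeM val_v (cong _) vp'); rewrite addr0 gerBl.
exists (- ev2 e t y (map_poly deriv Q) / s).
  have := D_ev2 t y Q; rewrite Qy -/s -(rmorph0 e) DC => /esym/eqP.
  rewrite addr_eq0 => /eqP e1; apply: (mulfI dQ).
  by rewrite mulrA mulrCA divff // mulr1 mulNr e1 opprK.
have -> : - ev2 e t y (map_poly deriv Q) / s = pev e t p^`() -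
  (ev2 e t y (map_poly deriv Q) + s * pev e t p^`()) * s^-1 by field.
apply: (vgeB val_v) => //.
apply: vgeW (vgeM val_v vy1 (vge_val (lexx (v s^-1)))).
by rewrite (valuationV val_v dQ) /n; move: (v s) => m; clear; lia.
Qed.

End ClosedPlaces.

(** * Holomorphic differentials *)

Section Holomorphic.
Variables (k : closedFieldType) (L : fieldType) (e : {rmorphism k -> L}).
Hypothesis char0 : [pchar k] =i pred0.
Hypothesis algL : forall t u, transcendental e t -> exists2 P, P != 0 & ev2 e t u P = 0.
Variables (x : L) (D : L -> L).
Hypothesis DD : forall u v, D (u + v) = D u + D v.
Hypothesis DM : forall u v, D (u * v) = u * D v + v * D u.
Hypothesis DC : forall a, D (e a) = 0.
Hypothesis Dx : D x = 1.

Lemma x_transcendental : transcendental e x.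
Proof.
apply: closed_transcendental => a; apply/eqP => xa.
by move: Dx; rewrite xa DC => /esym/eqP; rewrite oner_eq0.
Qed.

Lemma x_relation u : exists P, ev2 e x u P = 0 /\ ev2 e x u P^`() != 0.
Proof.
have [P nP Pu] := algL u x_transcendental.
exact: separable_relation char0 x_transcendental nP Pu.
Qed.

Notation hol := (holomorphic e (D : L -> L^o)).

Lemma hol_at w v t : hol w -> place e v -> t != 0 -> v t = 1 ->
  exists2 f, vge v 0 f & w = f * D t.
Proof.
move=> hw pl nt vt; have [t' [f [nt' vt' vf ->]]] := hw v pl.
have val_v := place_valuation pl.
have [|u -> vu] := place_regular char0 algL DD DM DC Dx pl nt vt (y := t').
  by rewrite vgeE // vt'.
exists (f * u); last by rewrite /GRing.scale /= mulrA.
apply: vgeW (vgeM val_v (_ : vge v 0 f) vu); first by [].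
by case: vf => [->|vf]; [exact: vge0|exact: vge_val].
Qed.

Lemma holD w w' : hol w -> hol w' -> hol (w + w').
Proof.
move=> hw hw' v pl; have [_ _ _ [t nt vt]] := pl.
have [f vf ->] := hol_at hw pl nt vt; have [f' vf' ->] := hol_at hw' pl nt vt.
exists t, (f + f'); split=> //; last by rewrite /GRing.scale /= mulrDl.
have := vgeD (place_valuation pl) vf vf'; rewrite /vge.
by move=> /orP[/eqP|]; [left|right].
Qed.

Lemma holZ a w : hol w -> hol (e a * w).
Proof.
move=> hw v pl; have [_ _ _ [t nt vt]] := pl.
have [f vf ->] := hol_at hw pl nt vt.
exists t, (e a * f); split=> //; last by rewrite /GRing.scale /= mulrA.
have := vgeM (place_valuation pl) (vgeC (place_valuation pl) a) vf; rewrite addr0 /vge.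
by move=> /orP[/eqP|]; [left|right].
Qed.

Lemma D_pullback (f : {rmorphism L -> L}) : (forall a, f (e a) = e a) ->
  forall u, D (f u) = f (D u) * D (f x).
Proof.
move=> fe u; apply/eqP; rewrite -subr_eq0; apply/eqP; move: u.
apply: (@derivation_unique _ _ _ e f L^o _ _ _ _ x) => [a b|a b|a||].
- by rewrite !rmorphD !DD rmorphD /=; ring.
- by rewrite /GRing.scale /= rmorphM !DM rmorphD !rmorphM; ring.
- by rewrite fe !DC rmorph0 mul0r subr0.
- by rewrite Dx rmorph1 mul1r subrr.
- exact: x_relation.
Qed.

Lemma hol_pullback (f : {rmorphism L -> L}) w : (forall a, f (e a) = e a) ->
  hol w -> hol (f w * D (f x)).
Proof.
move=> fe hw v pl; have val_v := place_valuation pl.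
have [vM vA vC] := val_v.
have val_V : valuation e (v \o f).
  split=> [a b na nb|a b na nb nab|a na] /=.
  - by rewrite rmorphM vM ?fmorph_eq0.
  - by rewrite rmorphD vA ?fmorph_eq0 // -rmorphD fmorph_eq0.
  - by rewrite fe vC.
have [y [ny vy]] : exists y, y != 0 /\ (v \o f) y != 0.
  have [p np vp] := place_nontrivial algL (f x) pl.
  have npx : pev e x p != 0 by apply: contraNneq np => /x_transcendental ->.
  have fp : pev e (f x) p = f (pev e x p).
    by rewrite rmorph_pev; apply: eq_pev => a /=; rewrite fe.
  exists (pev e x p); split=> //=; rewrite -fp.
  by case: vp => // /eqP; rewrite fp fmorph_eq0 (negPf npx).
have [v' [g [pl' g0 vE]]] := valuation_normalize val_V ny vy.
have [_ _ _ [t' nt' vt']] := pl'; have [_ _ _ [t nt vt]] := pl.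
have [h vh ->] := hol_at hw pl' nt' vt'.
have [|u Du vu] := place_regular char0 algL DD DM DC Dx pl nt vt (y := f t').
  by rewrite vgeE ?fmorph_eq0 //; have /= -> := vE _ nt'; rewrite vt'; lia.
exists t, (f h * u); split=> //; last first.
  by rewrite rmorphM -mulrA -D_pullback // Du /GRing.scale /= mulrA.
have vfh : vge v 0 (f h).
  move: vh; have [->|nh] := eqVneq h 0; first by rewrite rmorph0 !vge0.
  by rewrite !vgeE ?fmorph_eq0 //; have /= -> := vE _ nh; nia.
have := vgeM val_v vfh vu; rewrite addr0 /vge.
by move=> /orP[/eqP|]; [left|right].
Qed.

Lemma val_D v t y : place e v -> t != 0 -> v t = 1 -> y != 0 -> 0 < v y ->
  D y != 0 /\ v (D y) = v y - 1 + v (D t).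
Proof.
move=> pl nt vt ny vy; have val_v := place_valuation pl.
have [n vyE] : exists n : nat, v y = n.+1%:Z by exists `|v y|.-1; lia.
pose u := y / t ^+ n.+1.
have nu : u != 0 by rewrite mulf_neq0 // invr_eq0 expf_neq0.
have vu : v u = 0.
  rewrite (valuationM val_v) ?invr_eq0 ?expf_neq0 //.
  by rewrite (valuationV val_v) ?expf_neq0 // (valuationX val_v) // vt vyE; lia.
have yE : y = t ^+ n.+1 * u by rewrite /u mulrC divfK ?expf_neq0.
have [|u' Du vu'] := place_regular char0 algL DD DM DC Dx pl nt vt (y := u).
  by rewrite vgeE // vu.
have nDt : D t != 0.
  exact: (D_neq0 char0 algL DD DM DC Dx (place_transcendental pl nt vt)).
have DX m : D (t ^+ m.+1) = m.+1%:R * t ^+ m * D t.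
  elim: m => [|m IH]; first by rewrite expr1 expr0; ring.
  by rewrite exprS DM IH !exprS -[m.+2%:R]natr1; ring.
have -> : D y = t ^+ n * ((n.+1%:R * u + t * u') * D t).
  by rewrite yE DM DX Du exprS; ring.
have nn : (n.+1%:R : k) != 0 by move/pcharf0P: char0 => ->.
have nn' : (n.+1%:R : L) != 0 by rewrite -(rmorph_nat e) fmorph_eq0.
have vn : v (n.+1%:R * u) = 0.
  by rewrite (valuationM val_v) // vu -(rmorph_nat e) (valuationC val_v).
have [||nz vz] := val_dominant val_v (y := n.+1%:R * u) (z := t * u').
- by rewrite mulf_neq0.
- by rewrite vn; apply: vgeW (vgeM val_v (vge_val (lexx (v t))) vu'); rewrite vt.
rewrite !mulf_neq0 ?expf_neq0 //; split=> //.
rewrite (valuationM val_v) ?mulf_neq0 ?expf_neq0 // (valuationM val_v) //.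
by rewrite vz vn (valuationX val_v) // vt vyE; lia.
Qed.
End Holomorphic.

(** * Existence of places *)

Section ValuationRing.
Variables (k L : fieldType) (e : {rmorphism k -> L}) (pi : L).
Hypothesis pi_transc : transcendental e pi.

Lemma pi_neq0 : pi != 0.
Proof.
apply/eqP => pi0; have : pev e pi 'X = 0 by rewrite pevX.
by move=> /pi_transc /eqP; rewrite polyX_eq0.
Qed.

Definition pi_subring (S : set L) := [/\ forall a, S (e a),
  forall a b, S a -> S b -> S (a - b), forall a b, S a -> S b -> S (a * b),
  S pi & ~ S pi^-1].

Lemma subring_polys : pi_subring [set y | exists p, y = pev e pi p].
Proof.
split=> [a|_ _ [p ->] [q ->]|_ _ [p ->] [q ->]||].
- by exists a%:P; rewrite pevC.
- by exists (p - q); rewrite rmorphB.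
- by exists (p * q); rewrite rmorphM.
- by exists 'X; rewrite pevX.
case=> p pE; have : pev e pi (p * 'X - 1) = 0.
  by rewrite rmorphB rmorphM rmorph1 /= pevX -pE mulVf ?pi_neq0 // subrr.
move=> /pi_transc /(congr1 (fun q : {poly k} => q`_0)) /eqP.
by rewrite coefB coefMX coef1 coef0 sub0r oppr_eq0 oner_eq0.
Qed.

Lemma maximal_subring : exists2 S, pi_subring S &
  forall T, pi_subring T -> S `<=` T -> T `<=` S.
Proof.
(* set0 is allowed because of the empty chain. *)
pose P := [set S : set L | S = set0 \/ pi_subring S].
have [|A [PA Amax]] := @Zorn_bigcup L P.
  move=> F FP totF.
  have [->|/set0P[y0 [X0 FX0 X0y0]]] := eqVneq (\bigcup_(X in F) X) set0; first by left.
  have good X y : F X -> X y -> pi_subring X.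
    by move=> FX Xy; case: (FP _ FX) => // X0'; rewrite X0' in Xy.
  have two X Y a b : F X -> F Y -> X a -> Y b -> exists2 Z, F Z & Z a /\ Z b.
    by move=> FX FY Xa Yb; case: (totF _ _ FX FY) => sub; [exists Y|exists X]; auto.
  have [C0 _ _ pi0 _] := good _ _ FX0 X0y0.
  right; split=> [a|a b [X FX Xa] [Y FY Yb]|a b [X FX Xa] [Y FY Yb]||[X FX Xpi]].
  - by exists X0.
  - have [Z FZ [Za Zb]] := two _ _ _ _ FX FY Xa Yb.
    by exists Z => //; have [_ ZB _ _ _] := good _ _ FZ Za; exact: ZB.
  - have [Z FZ [Za Zb]] := two _ _ _ _ FX FY Xa Yb.
    by exists Z => //; have [_ _ ZM _ _] := good _ _ FZ Za; exact: ZM.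
  - by exists X0.
  - by have [_ _ _ _] := good _ _ FX Xpi; apply.
have Agood : pi_subring A.
  case: PA => // A0; exfalso; apply: (Amax _ _ (or_intror subring_polys)).
  rewrite A0; split; first exact: sub0set.
  by move=> /(_ 0); apply; exists 0; rewrite rmorph0.
exists A => // T Tgood AT; apply: contrapT => TA.
by apply: (Amax T); [split|right].
Qed.

Variable O : set L.
Hypothesis O_good : pi_subring O.
Hypothesis O_max : forall T, pi_subring T -> O `<=` T -> T `<=` O.

Lemma pi_subringC a : O (e a). Proof. by have [] := O_good. Qed.
Lemma pi_subring0 : O 0. Proof. by rewrite -(rmorph0 e); exact: pi_subringC. Qed.
Lemma pi_subring1 : O 1. Proof. by rewrite -(rmorph1 e); exact: pi_subringC. Qed.
Lemma pi_subringB a b : O a -> O b -> O (a - b). Proof. by have [_ + _ _ _] := O_good; apply. Qed.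
Lemma pi_subringM a b : O a -> O b -> O (a * b). Proof. by have [_ _ + _ _] := O_good; apply. Qed.
Lemma pi_subring_pi : O pi. Proof. by have [] := O_good. Qed.
Lemma pi_subring_piV : ~ O pi^-1. Proof. by have [] := O_good. Qed.

Lemma pi_subringD a b : O a -> O b -> O (a + b).
Proof.
move=> Oa Ob; have -> : a + b = a - (0 - b) by ring.
by apply: pi_subringB => //; apply: pi_subringB => //; exact: pi_subring0.
Qed.

Lemma pi_subringX a n : O a -> O (a ^+ n).
Proof.
move=> Oa; elim: n => [|n IH]; rewrite ?expr0 ?exprS; first exact: pi_subring1.
exact: pi_subringM.
Qed.

Lemma pi_subring_sum (I : Type) (r : seq I) (P : pred I) (F : I -> L) :
  (forall i, P i -> O (F i)) -> O (\sum_(i <- r | P i) F i).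
Proof. by move=> OF; elim/big_ind: _ => //; [exact: pi_subring0|exact: pi_subringD]. Qed.

Lemma adjoin_inv y : ~ O y ->
  exists q : {poly L}, (forall i, O q`_i) /\ pi^-1 = q.[y].
Proof.
move=> nOy; pose T := [set z | exists q : {poly L}, (forall i, O q`_i) /\ z = q.[y]].
have OT : O `<=` T.
  move=> z Oz; exists z%:P; rewrite hornerC; split=> // i.
  by rewrite coefC; case: eqP => _ //; exact: pi_subring0.
apply: contrapT => nT; apply: nOy.
have TO : T `<=` O.
  apply: O_max => //; split=> [a|_ _ [p [Op ->]] [q [Oq ->]]|_ _ [p [Op ->]] [q [Oq ->]]||//].
  - by apply: OT; exact: pi_subringC.
  - exists (p - q); rewrite hornerD hornerN; split=> // i.
    by rewrite coefB; exact: pi_subringB.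
  - exists (p * q); rewrite hornerM; split=> // i.
    by rewrite coefM; apply: pi_subring_sum => j _; exact: pi_subringM.
  - by apply: OT; exact: pi_subring_pi.
apply: TO; exists 'X; rewrite hornerX; split=> // i.
by rewrite coefX; case: eqP => _; [exact: pi_subring1|exact: pi_subring0].
Qed.

Lemma maximal_subring_unit b : O b -> 1 - pi * b != 0 /\ O (1 - pi * b)^-1.
Proof.
move=> Ob; set s := 1 - pi * b.
have ns : s != 0.
  rewrite subr_eq0; apply/eqP => pib; apply: pi_subring_piV.
  by rewrite -[pi^-1]mulr1 pib mulKf ?pi_neq0.
split=> //; apply: contrapT => /adjoin_inv[q [Oq qE]].
have cX n : exists2 c, O c & s ^+ n = 1 - pi * c.
  elim: n => [|n [c Oc cE]]; first by exists 0; [exact: pi_subring0|rewrite mulr0 subr0].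
  exists (b + c - pi * b * c); last by rewrite exprS cE /s; ring.
  apply: pi_subringB; first exact: pi_subringD.
  by do 2?[apply: pi_subringM => //]; exact: pi_subring_pi.
have Os : O s.
  by apply: pi_subringB; [exact: pi_subring1|apply: pi_subringM => //; exact: pi_subring_pi].
have Oy : O (s ^+ size q * pi^-1).
  rewrite qE horner_coef mulr_sumr; apply: pi_subring_sum => i _.
  rewrite mulrCA; apply: pi_subringM => //.
  rewrite exprVn -exprB ?unitfE //; first exact: pi_subringX.
  exact: ltnW.
apply: pi_subring_piV; have [c Oc cE] := cX (size q).
have -> : pi^-1 = s ^+ size q * pi^-1 + c by rewrite cE; field; exact: pi_neq0.
exact: pi_subringD.
Qed.

Lemma maximal_subring_valuation y : O y \/ O y^-1.
Proof.
apply: contrapT => /not_orP[nOy nOyV].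
have ny : y != 0 by apply/eqP => y0; apply: nOy; rewrite y0; exact: pi_subring0.
pose W n y := exists q : {poly L}, [/\ (size q <= n.+1)%N, forall i, O q`_i & pi^-1 = q.[y]].
have W_of z : ~ O z -> exists n, W n z.
  by move=> /adjoin_inv[q [Oq qE]]; exists (size q), q; split.
have key N n m z : (n + m <= N)%N -> z != 0 -> W n z -> W m z^-1 -> False.
  elim: N n m z => [|N IH] n m z.
    rewrite leqn0 addn_eq0 => /andP[/eqP-> _] _ [q [sq Oq qE]] _.
    apply: pi_subring_piV; rewrite qE (size1_polyC sq) hornerC; exact: Oq.
  wlog mn : n m z / (m <= n)%N.
    move=> wl nmN nz Wn Wm; have [mn|/ltnW nm] := leqP m n; first exact: (wl n m z).
    by apply: (wl m n z^-1) => //; rewrite ?invrK ?invr_eq0 // addnC.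
  case: n mn => [|n] mn nmN nz Wn Wm.
    case: Wn => q [sq Oq qE]; apply: pi_subring_piV.
    by rewrite qE (size1_polyC sq) hornerC; exact: Oq.
  have [q [sq Oq qE]] := Wn; have [q' [sq' Oq' qE']] := Wm.
  have [nd Od] := maximal_subring_unit (Oq' 0%N); set s := 1 - _ in nd Od.
  apply: (IH n m z) => //.
  exists (\poly_(i < n.+1) (q`_i + pi * s^-1 * q`_n.+1 * q'`_(n.+1 - i))).
  split; first exact: size_poly.
    move=> i; rewrite coef_poly; case: ifP => _; last exact: pi_subring0.
    by apply: pi_subringD => //; do ![apply: pi_subringM => //]; exact: pi_subring_pi.
  rewrite horner_poly; under eq_bigr do rewrite mulrDl -[_ * q'`_ _ * _]mulrA.
  rewrite big_split /= -mulr_sumr.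
  have -> : \sum_(i < n.+1) q'`_(n.+1 - i) * z ^+ i = z ^+ n.+1 * (s / pi).
    rewrite /s mulrBl mul1r mulrAC divff ?pi_neq0 // mul1r qE'.
    rewrite (@horner_coef_wide _ n.+2) ?(leq_trans sq') //.
    rewrite [in RHS]big_ord_recl expr0 mulr1 addrAC subrr add0r mulr_sumr.
    rewrite (reindex_inj rev_ord_inj) /=.
    apply: eq_bigr => i _; rewrite /bump /= add1n subKn //.
    by rewrite mulrCA exprVn -exprB ?unitfE.
  rewrite [LHS]qE (@horner_coef_wide _ n.+2 q) // big_ord_recr /=; congr (_ + _).
  by field; rewrite nd pi_neq0.
have [n Wn] := W_of _ nOy; have [m Wm] := W_of _ nOyV.
exact: (key _ _ _ _ (leqnn _) ny Wn Wm).
Qed.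

End ValuationRing.

Section PlaceExistence.
Variables (k L : fieldType) (e : {rmorphism k -> L}) (pi : L) (N : nat).
Hypothesis pi_transc : transcendental e pi.
Hypothesis pi_finite : forall u, exists2 P : {poly {poly k}},
  P != 0 & (size P <= N)%N /\ ev2 e pi u P = 0.

(* A subring maximal among those containing pi but not 1 / pi is a valuation ring.
   As L is finite over k(pi), for u != 0 two terms of a relation of degree at most N
   between pi and u have the same value, hence u ^+ N`! is a unit times an integral
   power pi ^ V u, and V is a valuation. *)
Lemma place_exists : exists2 v, place e v & 0 < v pi.
Proof.
have npi := pi_neq0 pi_transc.
have [O O_good O_max] := maximal_subring pi_transc.
have Oval := maximal_subring_valuation pi_transc O_good O_max.
have Ounit := maximal_subring_unit pi_transc O_good O_max.
have OC := pi_subringC O_good; have O1 := pi_subring1 O_good; have O0 := pi_subring0 O_good.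
have OM := pi_subringM O_good; have OX := pi_subringX O_good; have OD := pi_subringD O_good.
have Opi := pi_subring_pi O_good; have OpiV := pi_subring_piV O_good.
pose U a := [/\ a != 0, O a & O a^-1].
have U1 : U 1 by split; rewrite ?invr1 ?oner_neq0.
have UM a b : U a -> U b -> U (a * b).
  by move=> [na Oa OaV] [nb Ob ObV]; split; rewrite ?mulf_neq0 // ?invfM; apply: OM.
have UV a : U a -> U a^-1 by move=> [na Oa OaV]; split; rewrite ?invrK ?invr_eq0.
have UX a n : U a -> U (a ^+ n).
  by move=> Ua; elim: n => [|n IH]; rewrite ?expr0 ?exprS //; exact: UM.
have Uc a : a != 0 -> U (e a) by move=> na; split; rewrite ?fmorph_eq0 // -?fmorphV.
have Upoly p : p != 0 -> exists n, U (pev e pi p / pi ^+ n).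
  move=> np; have [n [q [q0 ->]]] := poly_X_factor np; exists n.
  rewrite rmorphM rmorphXn /= pevX mulfK ?expf_neq0 //.
  have Oq r : O (pev e pi r).
    rewrite pev_sum; apply: (pi_subring_sum O_good) => i _; apply: (OM) => //; exact: (OX).
  pose r : {poly k} := \poly_(i < (size q).-1) - (q`_i.+1 / q`_0).
  have -> : pev e pi q = e q`_0 * (1 - pi * pev e pi r).
    have qE : q = (q`_0)%:P * (1 - 'X * r).
      apply/polyP => -[|i]; rewrite coefCM coefB coef1 coefXM.
        by rewrite subr0 mulr1.
      rewrite sub0r /= coef_poly; case: ltnP => [_|le_i]; first by field.
      by rewrite oppr0 mulr0 nth_default //; case: (size q) le_i.
    by rewrite {1}qE rmorphM rmorphB rmorphM rmorph1 /= pevC pevX.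
  have [nd Od] := Ounit _ (Oq r).
  apply: (UM); first exact: Uc.
  by split=> //; apply: (pi_subringB O_good) => //; exact: OM.
have nonunit_sum n (F : 'I_n -> L) (P : pred 'I_n) : 
    (forall i, P i -> F i = 0 \/ ~ O (F i)^-1) ->
    \sum_(i | P i) F i = 0 \/ ~ O (\sum_(i | P i) F i)^-1.
  move=> FP; elim/big_ind: _ => [|a b|i /FP]; first by left.
    have [->|na] := eqVneq a 0; first by rewrite add0r.
    have [->|nb] := eqVneq b 0; first by rewrite addr0.
    move=> [a0|OaV]; first by rewrite a0 eqxx in na.
    move=> [b0|ObV]; first by rewrite b0 eqxx in nb.
    have [->|nab] := eqVneq (a + b) 0; [by left|right=> Oab].
    case: (Oval (a / b)) => [Oq|].
      apply: ObV; have -> : b^-1 = (1 + a / b) * (a + b)^-1 by field; rewrite nab nb.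
      by apply: (OM) => //; exact: OD.
    rewrite invf_div => Oq.
    apply: OaV; have -> : a^-1 = (1 + b / a) * (a + b)^-1 by field; rewrite nab na.
    by apply: (OM) => //; exact: OD.
  by [].
have least n (F : 'I_n -> L) : (exists i, F i != 0) ->
    exists2 i, F i != 0 & forall j, O (F j / F i).
  move=> [i0 ni0].
  suff H (s : seq 'I_n) : exists2 i, F i != 0 & forall j, j \in s -> O (F j / F i).
    have [i ni iP] := H (enum 'I_n); exists i => // j.
    by apply: iP; rewrite mem_enum.
  elim: s => [|j s [i ni IH]]; first by exists i0.
  case: (Oval (F j / F i)) => [Oq|].
    by exists i => // l; rewrite inE => /orP[/eqP->|/IH].
  rewrite invf_div => Oq.
  have [Fj0|nj] := eqVneq (F j) 0.
    by exists i => // l; rewrite inE => /orP[/eqP->|/IH //]; rewrite Fj0 mul0r.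
  exists j => // l; rewrite inE => /orP[/eqP->|/IH Ol]; first by rewrite divff.
  have -> : F l / F j = F l / F i * (F i / F j) by field; rewrite ni nj.
  exact: OM.
have two n (F : 'I_n -> L) : (exists i, F i != 0) -> \sum_i F i = 0 ->
    exists i j, [/\ i != j, F j != 0 & U (F i / F j)].
  move=> /least[j nj jP] F0; apply: contrapT => H.
  have nonU i : i != j -> F i / F j = 0 \/ ~ O (F i / F j)^-1.
    move=> ij; have [->|ni] := eqVneq (F i) 0; first by left; rewrite mul0r.
    right=> Oij; apply: H; exists i, j; split=> //.
    by split=> //; rewrite mulf_neq0 ?invr_eq0.
  have /nonunit_sum : forall i, i != j -> F i / F j = 0 \/ ~ O (F i / F j)^-1 := nonU.
  rewrite -mulr_suml; move: F0; rewrite (bigD1 j) //= => /eqP.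
  rewrite addrC addr_eq0 => /eqP ->; rewrite mulNr divff // invrN1 -(rmorphN1 e).
  by case=> [/eqP|]; [rewrite rmorphN1 oppr_eq0 oner_eq0|apply].
have Upi z : U (pi ^ z) -> z = 0.
  have H (n : nat) : ~ O (pi ^+ n.+1)^-1.
    move=> On; apply: OpiV; have -> : pi^-1 = pi ^+ n * (pi ^+ n.+1)^-1.
      by rewrite exprS; field; rewrite npi expf_neq0.
    by apply: (OM) => //; exact: (OX).
  case: z => [[|n]|n] // [_ Oz OzV]; first by have := H n OzV.
  by have := H n Oz.
have Vex u : exists z : int, u != 0 -> U (u ^+ N`! / pi ^ z).
  have [->|nu] := eqVneq u 0; first by exists 0.
  have [P nP [sP Pu]] := pi_finite u.
  pose F (i : 'I_(size P)) := pev e pi P`_i * u ^+ i.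
  have [||i [j [ij nj Uij]]] := two _ F.
  - have lt_P : ((size P).-1 < size P)%N by rewrite prednK ?size_poly_gt0.
    exists (Ordinal lt_P); rewrite /F mulf_neq0 ?expf_neq0 //= -lead_coefE.
    by apply: contraNneq nP => /pi_transc /eqP; rewrite lead_coef_eq0.
  - by rewrite -ev2_sum.
  have ni : F i != 0.
    by apply: contraTneq isT => Fi0; case: Uij; rewrite Fi0 mul0r eqxx.
  have npF a : F a != 0 -> P`_a != 0.
    by apply: contraNneq => Pa0; rewrite /F Pa0 rmorph0 mul0r.
  have fin (a b : 'I_(size P)) : (a < b)%N -> F a != 0 -> F b != 0 -> U (F b / F a) ->
      exists z : int, U (u ^+ N`! / pi ^ z).
    move=> ab na nb Uba.
    have [ma Ua] := Upoly _ (npF _ na); have [mb Ub] := Upoly _ (npF _ nb).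
    have npa : pev e pi P`_a != 0 by apply: contraNneq (npF _ na) => /pi_transc ->.
    have npb : pev e pi P`_b != 0 by apply: contraNneq (npF _ nb) => /pi_transc ->.
    have Um : U (u ^+ (b - a) / pi ^ (ma%:Z - mb%:Z)).
      have -> : u ^+ (b - a) / pi ^ (ma%:Z - mb%:Z) =
          F b / F a * (pev e pi P`_a / pi ^+ ma) * (pev e pi P`_b / pi ^+ mb)^-1.
        have ub : u ^+ b = u ^+ (b - a) * u ^+ a by rewrite -exprD subnK // ltnW.
        rewrite expfzDr // -exprnN -!exprnP /F ub.
        by field; rewrite npa npb !expf_neq0.
      by apply: (UM); [exact: UM|exact: UV].
    have /dvdnP[q qE] : (b - a %| N`!)%N.
      apply: dvdn_fact; rewrite subn_gt0 ab (leq_trans (leq_subr _ _)) //.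
      exact: leq_trans (ltnW (ltn_ord b)) sP.
    exists ((ma%:Z - mb%:Z) * q%:Z).
    have := UX _ q Um; rewrite exprMn -exprM mulnC -qE exprVn.
    by rewrite [(pi ^ _) ^+ q]exprnP exprz_exp.
  have [ltij|leji] := ltnP i j.
    have Uji : U (F j / F i) by rewrite -invf_div; exact: UV.
    by have [z Uz] := fin i j ltij ni nj Uji; exists z.
  have ltji : (j < i)%N by rewrite ltn_neqAle leji andbT eq_sym.
  by have [z Uz] := fin j i ltji nj ni Uij; exists z.
have [V VP] := choice Vex.
have Vuniq u z : u != 0 -> U (u ^+ N`! / pi ^ z) -> V u = z.
  move=> nu Uz; apply/eqP; rewrite -subr_eq0; apply/eqP/Upi.
  have -> : pi ^ (V u - z) = u ^+ N`! / pi ^ z * (u ^+ N`! / pi ^ V u)^-1.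
    by rewrite expfzDr // -invr_expz; field; rewrite !expfz_neq0 // expf_neq0.
  by apply: UM => //; exact/UV/VP.
have VM a b : a != 0 -> b != 0 -> V (a * b) = V a + V b.
  move=> na nb; apply: Vuniq; first by rewrite mulf_neq0.
  by rewrite exprMn expfzDr // -mulf_div; apply: (UM); exact: VP.
have V0 a : a != 0 -> O a -> 0 <= V a.
  move=> na Oa; have Ua := VP _ na; case E : (V a) => [//|n]; exfalso.
  case: Ua => _ _; rewrite E invfM invrK => Oy.
  apply: OpiV; have -> : pi^-1 = pi ^+ n * (a ^+ N`! * ((a ^+ N`!)^-1 * pi ^ Negz n)).
    by rewrite /exprz exprS; field; rewrite npi !expf_neq0.
  by apply: (OM); [exact: (OX)|apply: (OM); [exact: (OX)|exact: Oy]].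
have val_V : valuation e V.
  split=> // [|c nc]; last first.
    by apply: Vuniq; rewrite ?fmorph_eq0 // expr0z divr1; apply: UX; exact: Uc.
  have half a b : a != 0 -> b != 0 -> a + b != 0 -> O (a / b) -> Num.min (V a) (V b) <= V (a + b).
    move=> na nb nab Oab; rewrite ge_min; apply/orP; right.
    have abE : a + b = b * (1 + a / b) by field.
    have nq : 1 + a / b != 0 by apply: contraNneq nab => q0; rewrite abE q0 mulr0.
    rewrite abE.
    by rewrite VM // lerDl; apply: V0 => //; exact: OD.
  move=> a b na nb nab; case: (Oval (a / b)) => [|Oq]; first exact: half.
  by rewrite minC addrC; apply: half => //; rewrite 1?addrC // -invf_div.
have Vpi : V pi = (N`!)%:Z.
  by apply: Vuniq => //; rewrite -exprnP divff ?expf_neq0.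
have [|v [g [pl g0 vE]]] := valuation_normalize val_V npi.
  by rewrite Vpi; have := fact_gt0 N; lia.
exists v => //; have := vE _ npi; rewrite Vpi; have := fact_gt0 N; nia.
Qed.
End PlaceExistence.

(** * The space of holomorphic differentials is finite-dimensional *)

Section FunctionFieldPlaces.
Variables (k : closedFieldType) (K : fieldType) (c : {rmorphism k -> K}) (x : K).
Hypothesis x_transc : transcendental c x.
Hypothesis x_gen : forall S : set K, divring_closed [in S] ->
  (forall a, S (c a)) -> S x -> forall u, S u.
Variables (L : splittingFieldType K) (e : {rmorphism k -> L}).
Hypothesis eE : forall a, e a = (c a)%:A.

Lemma algebraicL t u : transcendental e t -> exists2 P, P != 0 & ev2 e t u P = 0.
Proof. exact: (algebraic_over x_transc (rational_x x_gen) eE). Qed.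

Lemma x_neqC a : x != c a.
Proof.
apply/eqP => xa; have : pev c x ('X - a%:P) = 0 by rewrite rmorphB /= pevX pevC xa subrr.
by move=> /x_transc /eqP; rewrite polyXsubC_eq0.
Qed.

Lemma x_neq0 : x != 0.
Proof. by rewrite -(rmorph0 c); exact: x_neqC. Qed.

Lemma place_above pi : (forall a, pi != c a) ->
  (exists p q, pev c pi q != 0 /\ x = pev c pi p / pev c pi q) ->
  exists2 v, place e v & 0 < v pi%:A.
Proof.
move=> npi x_pi; have tpi := closed_transcendental npi.
have rat_pi := rational_in x_gen x_pi.
apply: (@place_exists k L e pi%:A (\dim {:L}).+1).
  move=> p; rewrite (pev_in_alg _ eE) -in_algE => /eqP.
  by rewrite fmorph_eq0 => /eqP/tpi.
move=> u; have [P nP [sP Pu]] := relation_over_x tpi rat_pi eE u.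
exists P => //; split=> //; apply: leq_trans sP _.
have dA : \dim <<1; u>> = adjoin_degree 1 u by rewrite dim_Fadjoin dimv1 muln1.
by rewrite size_minPoly ltnS -dA dimvS ?subvf.
Qed.

Lemma place_finite a : exists2 v, place e v & 0 < v (x%:A - e a).
Proof.
have [||v pl v0] := @place_above (x - c a).
- move=> b; apply/eqP => xab; have /eqP := x_neqC (b + a); apply.
  by rewrite rmorphD -xab subrK.
- by exists ('X + a%:P), 1; rewrite rmorph1 oner_neq0 divr1 rmorphD /= pevX pevC subrK.
by exists v => //; rewrite eE -scalerBl.
Qed.

Lemma place_infinite : exists2 v, place e v & v x%:A < 0.
Proof.
have [||v pl v0] := @place_above x^-1.
- move=> b; apply/eqP => xb; have /eqP := x_neqC b^-1; apply.
  by rewrite fmorphV -xb invrK.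
- by exists 1, 'X; rewrite rmorph1 pevX invr_eq0 x_neq0 div1r invrK.
exists v => //; have val_v := place_valuation pl.
have := valuationV val_v (_ : x%:A != 0).
rewrite -in_algE -fmorphV fmorph_eq0 => /(_ x_neq0) e1.
by move: v0; rewrite -in_algE e1; lia.
Qed.
End FunctionFieldPlaces.

Section Poles.
Variables (k L : fieldType) (e : {rmorphism k -> L}) (v : L -> int) (t : L).
Hypothesis val_v : valuation e v.

Lemma val_pev_pole (p : {poly k}) : t != 0 -> v t < 0 -> p != 0 ->
  pev e t p != 0 /\ v (pev e t p) = (size p).-1%:Z * v t.
Proof.
move=> nt vt np; have sp : (0 < size p)%N by rewrite size_poly_gt0.
have pE : pev e t p = e (lead_coef p) * t ^+ (size p).-1 +
    \sum_(i < (size p).-1) e p`_i * t ^+ i.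
  by rewrite pev_sum lead_coefE; case: (size p) sp => // n _; rewrite big_ord_recr addrC.
have nl : e (lead_coef p) != 0 by rewrite fmorph_eq0 lead_coef_eq0.
have vl : v (e (lead_coef p) * t ^+ (size p).-1) = (size p).-1%:Z * v t.
  rewrite (valuationM val_v) ?expf_neq0 // (valuationC val_v) ?lead_coef_eq0 //.
  by rewrite (valuationX val_v) //; lia.
rewrite pE -vl; apply: (val_dominant val_v); first by rewrite mulf_neq0 ?expf_neq0.
rewrite vl; apply: (vge_sum val_v) => i _.
apply: vgeW (vgeM val_v (vgeC val_v _) (vgeX val_v i (vge_val (lexx (v t))))).
by have := ltn_ord i; nia.
Qed.

Lemma vge_pev_pole (p : {poly k}) n : t != 0 -> v t < 0 -> (size p <= n)%N ->
  vge v (n%:Z * v t) (pev e t p).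
Proof.
move=> nt vt sp; have [->|np] := eqVneq p 0; first by rewrite rmorph0 vge0.
have [_ vp] := val_pev_pole nt vt np.
by apply: vge_val; rewrite vp; nia.
Qed.

Variables (y : L) (P : {poly {poly k}}).
Hypotheses (nP : P != 0) (Py : ev2 e t y P = 0).

Let ly : pev e t (lead_coef P) * y ^+ (size P).-1 = - \sum_(i < (size P).-1) pev e t P`_i * y ^+ i.
Proof.
have sp : (0 < size P)%N by rewrite size_poly_gt0.
apply/eqP; rewrite -addr_eq0 addrC lead_coefE; apply/eqP; move: Py; rewrite ev2_sum.
by case: (size P) sp => // n _; rewrite big_ord_recr.
Qed.

Lemma vge_integral : pev e t (lead_coef P) != 0 -> vge v 0 t -> vge v 0 (pev e t (lead_coef P) * y).
Proof.
move=> nl vt; apply: contraT; rewrite negb_or mulf_eq0 (negPf nl) /= => /andP[ny].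
rewrite (valuationM val_v) // -ltNge => vy.
have vl : 0 <= v (pev e t (lead_coef P)) by rewrite -vgeE //; exact: vge_pev.
have n0 : (0 < (size P).-1)%N.
  rewrite lt0n; apply/eqP => sP0; move: ly; rewrite sP0 big_ord0 oppr0 expr0 mulr1 => /eqP.
  by rewrite (negPf nl).
have : vge v ((size P).-2%:Z * v y) (pev e t (lead_coef P) * y ^+ (size P).-1).
  rewrite ly (vgeN val_v); apply: (vge_sum val_v) => i _.
  apply: vgeW (vgeM val_v (vge_pev val_v _ vt) (vgeX val_v i (vge_val (lexx (v y))))).
  by have := ltn_ord i; nia.
rewrite vgeE ?mulf_neq0 ?expf_neq0 // (valuationM val_v) ?expf_neq0 // (valuationX val_v) //.
nia.
Qed.

Lemma vge_integral_pole N : t != 0 -> v t < 0 -> (forall i, (size (P`_i)%R <= N)%N) ->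
  vge v (N%:Z * v t) y.
Proof.
move=> nt vt sN; apply: contraT; rewrite negb_or => /andP[ny].
rewrite -ltNge => vy.
have nlP : lead_coef P != 0 by rewrite lead_coef_eq0.
have [nl vl] := val_pev_pole nt vt nlP.
have : vge v ((size P).-1%:Z * v y + 1) (pev e t (lead_coef P) * y ^+ (size P).-1).
  rewrite ly (vgeN val_v); apply: (vge_sum val_v) => i _.
  apply: vgeW (vgeM val_v (vge_pev_pole nt vt (sN i)) (vgeX val_v i (vge_val (lexx (v y))))).
  by have := ltn_ord i; nia.
rewrite vgeE ?mulf_neq0 ?expf_neq0 // (valuationM val_v) ?expf_neq0 // (valuationX val_v) //.
rewrite vl; nia.
Qed.
End Poles.

Lemma coprime_rational (k K : fieldType) (c : {rmorphism k -> K}) x (p q : {poly k}) :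
  pev c x q != 0 -> exists p' q', [/\ coprimep p' q', pev c x q' != 0 &
    pev c x p / pev c x q = pev c x p' / pev c x q'].
Proof.
move=> nq; have nq0 : q != 0 by apply: contraNneq nq => ->; rewrite rmorph0.
have pE := divpK (dvdp_gcdl p q); have qE := divpK (dvdp_gcdr p q).
exists (p %/ gcdp p q), (q %/ gcdp p q).
have evp : pev c x p = pev c x (p %/ gcdp p q) * pev c x (gcdp p q) by rewrite -rmorphM pE.
have evq : pev c x q = pev c x (q %/ gcdp p q) * pev c x (gcdp p q) by rewrite -rmorphM qE.
move: nq; rewrite evq mulf_eq0 negb_or => /andP[nq ng].
split=> //; last by rewrite evp -mulf_div divff ?mulr1.
by apply: coprimep_div_gcd; rewrite nq0 orbT.
Qed.

Section HolomorphicDimension.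
Variables (k : closedFieldType) (K : fieldType) (c : {rmorphism k -> K}) (x : K).
Hypothesis char0 : [pchar k] =i pred0.
Hypothesis x_transc : transcendental c x.
Hypothesis x_gen : forall S : set K, divring_closed [in S] ->
  (forall a, S (c a)) -> S x -> forall u, S u.
Variables (L : splittingFieldType K) (e : {rmorphism k -> L}).
Hypothesis galL : galois 1 {:L}.
Hypothesis eE : forall a, e a = (c a)%:A.
Variable D : L -> L.
Hypothesis DD : forall u v, D (u + v) = D u + D v.
Hypothesis DM : forall u v, D (u * v) = u * D v + v * D u.
Hypothesis DC : forall a, D (e a) = 0.
Hypothesis Dx : D x%:A = 1.

Let algL := algebraicL x_transc x_gen eE.
Notation hol := (holomorphic e (D : L -> L^o)).
Notation X := (x%:A : L).

Lemma X_transc : transcendental e X.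
Proof.
by move=> p; rewrite (pev_in_alg _ eE) -in_algE => /eqP; rewrite fmorph_eq0 => /eqP/x_transc.
Qed.

Lemma X_neq0 : X != 0.
Proof. by rewrite -in_algE fmorph_eq0 (x_neq0 x_transc). Qed.

Lemma hol_finite v a w : place e v -> hol w -> 0 < v (X - e a) -> vge v (1 - v (X - e a)) w.
Proof.
move=> pl hw va; have val_v := place_valuation pl; have [_ _ _ [t nt vt]] := pl.
have nXa : X - e a != 0.
  apply/eqP => Xa; have : pev e X ('X - a%:P) = 0 by rewrite rmorphB /= pevX pevC.
  by move=> /X_transc /eqP; rewrite polyXsubC_eq0.
have [f vf ->] := hol_at char0 algL DD DM DC Dx hw pl nt vt.
have := val_D char0 algL DD DM DC Dx pl nt vt nXa va.
have -> : D (X - e a) = 1.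
  have := DD (X - e a) (e a); rewrite subrK DC addr0 => <-; exact: Dx.
rewrite (valuation1 val_v) => -[_ vDt].
by apply: vgeW (vgeM val_v vf (vge_val (lexx (v (D t))))); lia.
Qed.

Lemma hol_infinite v w : place e v -> hol w -> v X < 0 -> vge v (1 - v X) w.
Proof.
move=> pl hw va; have val_v := place_valuation pl; have [_ _ _ [t nt vt]] := pl.
have nX := X_neq0.
have [f vf ->] := hol_at char0 algL DD DM DC Dx hw pl nt vt.
have nXV : X^-1 != 0 by rewrite invr_eq0.
have vXV := valuationV val_v nX.
have [|] := val_D char0 algL DD DM DC Dx pl nt vt nXV; first by rewrite vXV; lia.
have -> : D X^-1 = - X^-1 ^+ 2.
  have := DM X X^-1; rewrite divff // Dx mulr1 -{1}(rmorph1 e) DC => /eqP.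
  rewrite eq_sym addr_eq0 => /eqP e1; apply: (mulfI nX); rewrite e1.
  by field.
move=> _; rewrite (valuationN val_v) (valuationX val_v) // vXV => vDt.
by apply: vgeW (vgeM val_v vf (vge_val (lexx (v (D t))))); lia.
Qed.

Lemma gal_e (s : gal_of {:L}) a : s (e a) = e a.
Proof. by rewrite eE linearZ rmorph1. Qed.

Lemma gal_X (s : gal_of {:L}) : s X = X.
Proof. by rewrite linearZ rmorph1. Qed.

Lemma gal_pev (s : gal_of {:L}) p : s (pev e X p) = pev e X p.
Proof.
by rewrite rmorph_pev /= gal_X; apply: eq_pev => a /=; exact: gal_e.
Qed.

Lemma hol_gal (s : gal_of {:L}) w : hol w -> hol (s w).
Proof.
move=> /(hol_pullback char0 algL DD DM DC Dx (gal_e s)).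
by rewrite /= gal_X Dx mulr1.
Qed.

Lemma integral_multiple b : exists s (N : nat), [/\ pev e X s != 0,
  forall (g : gal_of {:L}) v, place e v -> vge v 0 X -> vge v 0 (g (pev e X s * b)) &
  forall (g : gal_of {:L}) v, place e v -> v X < 0 -> vge v (N%:Z * v X) (g (pev e X s * b))].
Proof.
have [P nP [_ Pb]] := relation_over_x x_transc (rational_x x_gen) eE b.
have Pg (g : gal_of {:L}) : ev2 e X (g b) P = 0.
  rewrite -(rmorph0 g) -Pb !ev2E -horner_map -map_poly_comp.
  by congr (_.[_]); apply: eq_map_poly => p /=; rewrite gal_pev.
have ns : pev e X (lead_coef P) != 0.
  by apply: contraNneq nP => /X_transc/eqP; rewrite lead_coef_eq0.
pose N := \max_(i < size P) size (P`_i)%R.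
have sN i : (size (P`_i)%R <= N)%N.
  have [lti|gei] := ltnP i (size P); first exact: (leq_bigmax (Ordinal lti)).
  by rewrite nth_default // size_poly0.
have nX := X_neq0.
exists (lead_coef P), (N + size (lead_coef P))%N; split=> // g v pl vX; 
  have val_v := place_valuation pl; rewrite rmorphM /= gal_pev.
  by apply: (vge_integral val_v nP (Pg g)).
have v1 := vge_pev_pole val_v nX vX (leqnn (size (lead_coef P))).
apply: vgeW (vgeM val_v v1 (vge_integral_pole val_v nP (Pg g) nX vX sN)).
by rewrite PoszD mulrDl addrC.
Qed.

Lemma trace_polynomial w y N : hol w ->
  (forall (g : gal_of {:L}) v, place e v -> vge v 0 X -> vge v 0 (g y)) ->
  (forall (g : gal_of {:L}) v, place e v -> v X < 0 -> vge v (N%:Z * v X) (g y)) ->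
  exists2 p : {poly k}, (size p <= N)%N & galTrace 1 {:L} (w * y) = pev e X p.
Proof.
move=> hw y_fin y_inf; set u := galTrace _ _ _.
have /vlineP[h hE] : u \in 1%VS by apply: mem_galTrace => //; exact: memvf.
have [p0 [q0 [nq0 h0]]] := rational_x x_gen h.
have [p [q [cop nq pq]]] := coprime_rational p0 nq0.
have uq : u * pev e X q = pev e X p.
  rewrite hE h0 pq !(pev_in_alg _ eE) -!in_algE -rmorphM.
  by rewrite divfK.
have sq : size q = 1%N.
  apply/eqP; apply: contraT => /closed_rootP[a qa].
  have npa : ~~ root p a by apply: contraL qa => pa; exact: (coprimep_root cop pa).
  have [v pl va] := place_finite x_transc x_gen eE a.
  have val_v := place_valuation pl.
  have vX : vge v 0 X.
    rewrite -[X](subrK (e a)); apply: (vgeD val_v); last exact: vgeC.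
    by apply: vge_val; exact: ltW.
  have vu : vge v (1 - v (X - e a)) u.
    apply: (vge_sum val_v) => g _; rewrite rmorphM /=.
    by have := vgeM val_v (hol_finite pl (hol_gal g hw) va) (y_fin g v pl vX); rewrite addr0.
  have vq : vge v (v (X - e a)) (pev e X q).
    have /factor_theorem[r ->] := qa; rewrite rmorphM rmorphB /= pevX pevC.
    by have := vgeM val_v (vge_pev val_v r vX) (vge_val (lexx (v (X - e a)))); rewrite add0r.
  have := vgeM val_v vu vq; rewrite uq.
  have -> : pev e X p = pev e (X - e a) (p \Po ('X + a%:P)).
    rewrite !pevE map_comp_poly rmorphD /= map_polyX map_polyC.
    by rewrite horner_comp hornerD hornerX hornerC subrK.
  have v1 : vge v 1 (X - e a) by apply: vge_val; rewrite -gtz0_ge1.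
  have [|np vp] := val_pev val_v v1 (_ : (p \Po ('X + a%:P))`_0 != 0).
    by rewrite -horner_coef0 horner_comp hornerD hornerX hornerC add0r.
  by rewrite vgeE // vp subrK.
have [b qb] : exists b, q = b%:P by exists q`_0; exact: (size1_polyC (eq_leq sq)).
have nb : b != 0 by apply/eqP => b0; move: sq; rewrite qb b0 polyC0 size_poly0.
have up : u = pev e X (b^-1 *: p).
  rewrite -mul_polyC rmorphM /= pevC fmorphV -uq qb pevC mulrC mulfK //.
  by rewrite fmorph_eq0.
exists (b^-1 *: p) => //; rewrite leqNgt; apply/negP => sp.
have [v pl vX] := place_infinite x_transc x_gen eE.
have val_v := place_valuation pl.
have vu : vge v (1 - v X + N%:Z * v X) u.
  apply: (vge_sum val_v) => g _; rewrite rmorphM /=.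
  exact: (vgeM val_v (hol_infinite pl (hol_gal g hw) vX) (y_inf g v pl vX)).
have np : b^-1 *: p != 0 by rewrite -size_poly_gt0; exact: leq_ltn_trans sp.
have [nu vup] := val_pev_pole val_v X_neq0 vX np.
move: vu; rewrite up vgeE // vup; move: sp vX => {up vup nu np}.
move: (size _) (v X) => m z; nia.
Qed.

(* The traces of w y, for y in a basis of L over k(x) integral over k[x], are polynomials
   of bounded degree, and determine w because the trace of w w^-1 is not 0. *)
Lemma hol_dependent : exists r, forall w : 'I_r -> L, (forall l, hol (w l)) ->
  exists2 a : 'I_r -> k, exists l, a l != 0 & \sum_l e (a l) * w l = 0.
Proof.
set n := \dim {:L}; set b := vbasis {:L}.
have [s /choice[N sN]] := choice (fun i : 'I_n => integral_multiple b`_i).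
pose y i := pev e X (s i) * b`_i.
pose M := (\max_i N i)%N.
exists (n * M).+1 => w hw.
have tr l i : exists p : {poly k}, (size p <= M)%N /\ galTrace 1 {:L} (w l * y i) = pev e X p.
  have [_ y_fin y_inf] := sN i.
  have [p sp pE] := trace_polynomial (hw l) y_fin y_inf.
  by exists p; split=> //; apply: leq_trans sp _; exact: leq_bigmax.
have [p pP] := choice (fun li : 'I_(n * M).+1 * 'I_n => tr li.1 li.2).
pose A : 'M[k]_((n * M).+1, n * M) :=
  \matrix_(l < (n * M).+1) mxvec (\matrix_(i < n, j < M) (p (l, i))`_j).
have : kermx A != 0.
  by rewrite kermx_eq0 /row_free neq_ltn ltnS rank_leq_col.
move=> /rowV0Pn[a /sub_kermxP aA na].
exists (fun l => a 0 l).
  apply: contrapT => H; move/eqP: na; apply; apply/rowP => l; rewrite mxE.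
  by apply/eqP; apply: contraT => nal; exfalso; apply: H; exists l.
set u := \sum_l _.
have trZ (g : K) z : galTrace 1 {:L} (g%:A * z) = g%:A * galTrace 1 {:L} z.
  rewrite /galTrace mulr_sumr; apply: eq_bigr => f _.
  by rewrite rmorphM /= linearZ rmorph1.
have tru i : galTrace 1 {:L} (u * y i) = 0.
  rewrite /u mulr_suml raddf_sum /=.
  have -> : \sum_l galTrace 1 {:L} (e (a 0 l) * w l * y i) =
      pev e X (\sum_l a 0 l *: p (l, i)).
    rewrite (rmorph_sum (pev e X)); apply: eq_bigr => l _ /=.
    have [_ pE] := pP (l, i).
    by rewrite -mulrA eE trZ pE -mul_polyC rmorphM /= pevC eE.
  rewrite (_ : \sum_l _ = 0) ?rmorph0 //; apply/polyP => j; rewrite coef0 coef_sum.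
  have [ltj|gej] := ltnP j M; last first.
    apply: big1 => l _; rewrite coefZ nth_default ?mulr0 //.
    by have [sp _] := pP (l, i); exact: leq_trans gej.
  have := congr1 (fun B : 'rV_(n * M) => B 0 (mxvec_index i (Ordinal ltj))) aA.
  rewrite mxE [RHS]mxE => a0; rewrite -[RHS]a0; apply: eq_bigr => l _.
  by rewrite coefZ !mxE mxvecE mxE.
apply/eqP; apply: contraT => nu.
have : galTrace 1 {:L} (u * u^-1) = 0.
  rewrite (coord_vbasis (memvf u^-1)) mulr_sumr raddf_sum big1 // => i _ /=.
  have [ns _ _] := sN i.
  set z := coord _ _ _.
  have -> : u * (z *: b`_i) = (z / pev c x (s i))%:A * (u * y i).
    have -> : (z / pev c x (s i))%:A = z%:A / pev e X (s i) :> L.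
      by rewrite (pev_in_alg _ eE); exact: (fmorph_div (in_alg L)).
    by rewrite /y -[z *: _]mulr_algl; field.
  by rewrite trZ tru mulr0.
rewrite divff // /galTrace => /eqP.
under eq_bigr do rewrite rmorph1.
rewrite sumr_const -(rmorph_nat e) fmorph_eq0.
by move/pcharf0P: char0 => ->; rewrite (gtn_eqF (cardG_gt0 _)).
Qed.

End HolomorphicDimension.

Lemma eigenvector_mod (k : closedFieldType) (L : fieldType) (e : {rmorphism k -> L})
    (T : L -> L) (V W : set L) (r : nat) (w : L) :
  (forall u v, T (u + v) = T u + T v) -> (forall a u, T (e a * u) = e a * T u) ->
  (forall u, V u -> V (T u)) -> (forall u v, V u -> V v -> V (u + v)) ->
  (forall a u, V u -> V (e a * u)) -> (forall a u, W u -> W (e a * u)) -> W 0 ->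
  (forall u : 'I_r -> L, (forall l, V (u l)) ->
     exists2 a : 'I_r -> k, exists l, a l != 0 & \sum_l e (a l) * u l = 0) ->
  V w -> ~ W w -> exists u lam, [/\ V u, ~ W u & W (T u - e lam * u)].
Proof.
move=> TD TZ VT VD VZ WZ W0 dep Vw nWw.
have key n (p : {poly k}) u : (size p <= n)%N -> p != 0 -> V u -> ~ W u ->
    W (\sum_(i < n) e p`_i * iter i T u) ->
    exists u lam, [/\ V u, ~ W u & W (T u - e lam * u)].
  elim: n p u => [|n IH] p u sp np Vu nWu Wp.
    by move: sp; rewrite leqn0 size_poly_eq0 (negPf np).
  have [p1|np1] := eqVneq (size p) 1.
    have p0 : p`_0 != 0 by move: np; rewrite {1}(size1_polyC (eq_leq p1)) polyC_eq0.
    exfalso; apply: nWu; have := WZ (p`_0)^-1 _ Wp.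
    rewrite big_ord_recl big1 ?addr0 => [|i _]; last first.
      by rewrite nth_default ?rmorph0 ?mul0r // p1.
    by rewrite /= mulrA -rmorphM mulVf // rmorph1 mul1r.
  have [lam /factor_theorem[q pE]] := closed_rootP p np1.
  have nq : q != 0 by apply: contraNneq np => q0; rewrite pE q0 mul0r.
  have sq : (size q <= n)%N.
    by move: sp; rewrite pE size_Mmonic ?monicXsubC // size_XsubC addn2.
  pose u' := T u - e lam * u.
  have [Wu'|nWu'] := pselect (W u'); first by exists u, lam.
  apply: (IH q u') => //.
    have -> : u' = T u + e (- lam) * u by rewrite rmorphN mulNr.
    by apply: VD; [exact: VT|exact: VZ].
  suff <- : \sum_(i < n.+1) e p`_i * iter i T u = \sum_(i < n) e q`_i * iter i T u' by [].
  have iT i : iter i T u' = iter i.+1 T u - e lam * iter i T u.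
    elim: i => // i IHi; rewrite !iterS IHi.
    have -> : iter i.+1 T u - e lam * iter i T u = iter i.+1 T u + e (- lam) * iter i T u.
      by rewrite rmorphN mulNr.
    by rewrite TD TZ rmorphN mulNr !iterS.
  under [RHS]eq_bigr do rewrite iT mulrBr.
  have -> : \sum_(i < n.+1) e p`_i * iter i T u =
     \sum_(i < n.+1) e (q * 'X)`_i * iter i T u -
     \sum_(i < n.+1) e (q`_i * lam) * iter i T u.
    rewrite -sumrB; apply: eq_bigr => i _.
    by rewrite pE mulrBr coefB coefMC rmorphB mulrBl.
  rewrite big_ord_recl coefMX rmorph0 mul0r add0r.
  rewrite [X in _ - X]big_ord_recr /= [q`_n]nth_default // mul0r rmorph0 mul0r addr0.
  rewrite -sumrB; apply: eq_bigr => i _.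
  by rewrite coefMX /= rmorphM mulrA.
have ViT i : V (iter i T w) by elim: i => //= i; exact: VT.
have [a [l nal] a0] := dep (fun i : 'I_r => iter i T w) (fun i => ViT i).
pose p : {poly k} := \poly_(i < r) (if insub i is Some j then a j else 0).
have pa (i : 'I_r) : p`_i = a i by rewrite coef_poly ltn_ord valK.
apply: (key r p w) => //; first exact: size_poly.
  by apply: contraNneq nal => p0; rewrite -pa p0 coef0.
by under eq_bigr do rewrite pa; rewrite a0.
Qed.

Section Genus.
Variables (k : closedFieldType) (K : fieldType) (c : {rmorphism k -> K}) (x : K).
Hypothesis char0 : [pchar k] =i pred0.
Hypothesis x_transc : transcendental c x.
Hypothesis x_gen : forall S : set K, divring_closed [in S] ->
  (forall a, S (c a)) -> S x -> forall u, S u.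
Variables (L : splittingFieldType K) (e : {rmorphism k -> L}).
Hypothesis galL : galois 1 {:L}.
Hypothesis eE : forall a, e a = (c a)%:A.

(* If w1, w2 are independent holomorphic differentials which triangularize the pullback
   by f, then w2 / w1 is mapped by f to an affine function of itself. *)
Lemma genus_or_affine (f : {rmorphism L -> L}) : (forall a, f (e a) = e a) ->
  has_genus e 0 \/ has_genus e 1 \/
  exists u, (forall a, u != e a) /\ exists a b, f u = e a * u + e b.
Proof.
move=> fe; have [D [DD DM DC' Dx]] := function_field_derivation x_transc x_gen galL.
have DC a : D (e a) = 0 by rewrite eE DC'.
have algL := algebraicL x_transc x_gen eE.
have kae : kaehler e (D : L -> L^o).
  exact: (kaehler_regular (x_relation char0 algL DC Dx) DD DM DC Dx).
pose hol := holomorphic e (D : L -> L^o).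
have [r dep] := hol_dependent char0 x_transc x_gen galL eE DD DM DC Dx.
have holD := holD char0 algL DD DM DC Dx.
have holZ := holZ char0 algL DD DM DC Dx.
pose T w := f w * D (f x%:A).
have TD u v : T (u + v) = T u + T v by rewrite /T rmorphD mulrDl.
have TZ a u : T (e a * u) = e a * T u by rewrite /T rmorphM /= fe mulrA.
have holT u : hol u -> hol (T u) by exact: (hol_pullback char0 algL DD DM DC Dx fe).
have nDf : D (f x%:A) != 0.
  apply: (D_neq0 char0 algL DD DM DC Dx); move=> p.
  rewrite -(eq_pev _ _ (fe : f \o e =1 e)) -rmorph_pev => /eqP; rewrite fmorph_eq0 => /eqP.
  exact: (X_transc x_transc eE).
have T0 u : T u = 0 -> u = 0.
  by move/eqP; rewrite mulf_eq0 (negPf nDf) orbF fmorph_eq0 => /eqP.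
have [V0|] := pselect (forall w, hol w -> w = 0).
  left; exists L^o, D; split=> //; exists (fun=> 0); split=> [i|w /V0 ->].
    by case: i.
  exists [ffun=> 0]; split=> [|a _]; first by rewrite big_ord0.
  by apply/ffunP => -[].
move=> /existsNP[w0 /not_implyP[hw0 nw0]].
have [||||||| w1 [lam [hw1 nw1 /eqP]]] := @eigenvector_mod k L e T hol [set 0] r w0 TD TZ holT.
- by move=> u v; exact: holD.
- by move=> a u; exact: holZ.
- by move=> a u ->; rewrite mulr0.
- by [].
- exact: dep.
- by [].
- by [].
rewrite subr_eq0 => /eqP Tw1.
have nw1' : w1 != 0 by apply/eqP.
have [V1|] := pselect (forall w, hol w -> exists a, w = e a * w1).
  right; left; exists L^o, D; split=> //; exists (fun=> w1); split=> // w /V1[a ->].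
  exists [ffun=> a]; split=> [|b].
    by rewrite big_ord_recl big_ord0 addr0 ffunE.
  rewrite big_ord_recl big_ord0 addr0 => /(mulIf nw1')/fmorph_inj ab.
  by apply/ffunP => i; rewrite ffunE ab; congr (b _); apply/val_inj; case: i => -[].
move=> /existsNP[w2' /not_implyP[hw2' nw2']]; right; right.
have [||||||| w2 [mu [hw2 nw2 [nu Tw2]]]] :=
    @eigenvector_mod k L e T hol [set w | exists a, w = e a * w1] r w2' TD TZ holT.
- by move=> u v; exact: holD.
- by move=> a u; exact: holZ.
- by move=> a u [b ->]; exists (a * b); rewrite rmorphM mulrA.
- by exists 0; rewrite rmorph0 mul0r.
- exact: dep.
- by [].
- by [].
have nlam : lam != 0.
  by apply: contraNneq nw1' => lam0; apply/eqP/T0; rewrite Tw1 lam0 rmorph0 mul0r.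
exists (w2 / w1); split=> [a|].
  by apply/eqP => q; apply: nw2; exists a; rewrite -q divfK.
exists (mu / lam), (nu / lam).
have Tw2' : T w2 = e mu * w2 + e nu * w1 by rewrite -Tw2; ring.
have nel : e lam != 0 by rewrite fmorph_eq0.
rewrite fmorph_div !(fmorph_div e) /=.
have -> : f w2 = T w2 / D (f x%:A) by rewrite /T mulfK.
have -> : f w1 = T w1 / D (f x%:A) by rewrite /T mulfK.
rewrite Tw2' Tw1; field.
by rewrite nel nDf nw1'.
Qed.
End Genus.

(** * Composition of rational functions *)

Section Composition.
Variable k : fieldType.
Notation rat_const := (@rat_const k).
Notation tofrac := (@FracField.tofrac {poly k}).

Lemma pev_rat_const : pev rat_const (tofrac 'X) =1 tofrac.
Proof.
elim/poly_ind => [|p a IH]; first by rewrite !rmorph0.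
by rewrite !rmorphD !rmorphM /= pevX pevC IH.
Qed.

Lemma composition_rmorphism g : transcendental rat_const g ->
  exists h : {rmorphism ratfun k -> ratfun k},
  [/\ forall a, h (rat_const a) = rat_const a, h (tofrac 'X) = g,
      forall p, h (tofrac p) = pev rat_const g p & forall f, h f = rat_comp f g].
Proof.
move=> tg; have [|h hE] := @rmorphism_factor _ _ tofrac (@fraction_rational k) _ (pev rat_const g).
  move=> p; rewrite tofrac_eq0.
  by apply/eqP/eqP => [/tg|->]; rewrite ?rmorph0.
exists h; split=> [a||//|f]; [by rewrite (hE a%:P) /= pevC|by rewrite hE /= pevX|].
by rewrite {1}(fraction_repr f) fmorph_div !hE.
Qed.

Lemma rat_repr (f : ratfun k) : exists p q : {poly k},
  [/\ coprimep p q, q != 0, f = tofrac p / tofrac q &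
      rat_degree f = (maxn (size p) (size q)).-1].
Proof.
have nq : \d_(repr f) != 0 by exact: denom_ratioP.
have := fraction_repr f; rewrite /rat_degree.
move: (\n_(repr f)) (\d_(repr f)) nq => p q nq fE.
have pE := divpK (dvdp_gcdl p q); have qE := divpK (dvdp_gcdr p q).
have tp : tofrac p = tofrac (p %/ gcdp p q) * tofrac (gcdp p q) by rewrite -rmorphM pE.
have tq : tofrac q = tofrac (q %/ gcdp p q) * tofrac (gcdp p q) by rewrite -rmorphM qE.
have : tofrac q != 0 by rewrite tofrac_eq0.
rewrite {1}tq mulf_eq0 negb_or !tofrac_eq0 => /andP[nq' ng].
exists (p %/ gcdp p q), (q %/ gcdp p q); split=> //.
  by apply: coprimep_div_gcd; rewrite nq orbT.
by rewrite fE tp tq -mulf_div divff ?mulr1 // tofrac_eq0.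
Qed.

Lemma rat_nonconstant f a : (0 < rat_degree f)%N -> f != rat_const a.
Proof.
have [p [q [cop nq fE ->]]] := rat_repr f.
apply: contraTneq => fa; rewrite -leqNgt.
have pq : p = a%:P * q.
  by apply/eqP; rewrite -tofrac_eq rmorphM /= -[tofrac a%:P]/(rat_const a) -fa fE divfK ?tofrac_eq0.
have sq : size q = 1%N.
  apply/eqP; rewrite -(coprimepp q); move: cop; rewrite pq => cop.
  exact: coprimep_dvdr (dvdp_mull _ (dvdpp q)) cop.
have : (size p <= 1)%N by rewrite pq mul_polyC -sq size_scale_leq.
by rewrite sq; case: (size p) => [|[]].
Qed.
End Composition.

Lemma homogenize_term (F : fieldType) (a u v : F) i j : v != 0 ->
  a * (u / v) ^+ i = a * (u ^+ i * v ^+ j) / (v ^+ i * v ^+ j).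
Proof. by move=> nv; rewrite expr_div_n; field; rewrite !expf_neq0. Qed.

Lemma affine_cross (F : fieldType) (P Q b p q al be : F) : Q != 0 -> b != 0 -> q != 0 ->
  P / b / (Q / b) = al * (p / q) + be -> P * q = (al * p + be * q) * Q.
Proof.
move=> nQ nb nq e1; have -> : P = P / b / (Q / b) * Q by field; rewrite nQ nb.
by rewrite e1; field.
Qed.

Section DegreeOfComposite.
Variable k : closedFieldType.
Notation rat_const := (@rat_const k).
Notation tofrac := (@FracField.tofrac {poly k}).

Definition form n (p : {poly k}) (s t : k) := \sum_(i < n.+1) p`_i * s ^+ i * t ^+ (n - i).
Definition form_poly n (p a b : {poly k}) := \sum_(i < n.+1) p`_i *: (a ^+ i * b ^+ (n - i)).

Lemma form_common_zero n p q s t : coprimep p q -> maxn (size p) (size q) = n.+1 ->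
  form n p s t = 0 -> form n q s t = 0 -> s = 0 /\ t = 0.
Proof.
move=> cop sn fp fq.
have [t0|nt] := eqVneq t 0.
  have f0 r : form n r s 0 = r`_n * s ^+ n.
    rewrite /form big_ord_recr /= subnn expr0 mulr1 big1 ?add0r // => i _.
    by rewrite [0 ^+ _]expr0n subn_eq0 leqNgt ltn_ord mulr0.
  split=> //; apply/eqP; apply: contraT => ns.
  move: fp fq; rewrite t0 !f0 => /eqP; rewrite mulf_eq0 expf_eq0 (negPf ns) andbF orbF => /eqP pn.
  move=> /eqP; rewrite mulf_eq0 expf_eq0 (negPf ns) andbF orbF => /eqP qn.
  case: (leqP (size p) (size q)) => [pq|/ltnW pq].
    have sq : size q = n.+1 by rewrite -sn (maxn_idPr pq).
    by move: qn => /eqP; rewrite -[n]/(n.+1.-1) -sq -lead_coefE lead_coef_eq0 -size_poly_eq0 sq.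
  have sp : size p = n.+1 by rewrite -sn (maxn_idPl pq).
  by move: pn => /eqP; rewrite -[n]/(n.+1.-1) -sp -lead_coefE lead_coef_eq0 -size_poly_eq0 sp.
have f1 (r : {poly k}) : (size r <= n.+1)%N -> form n r s t = t ^+ n * r.[s / t].
  move=> sr; rewrite (horner_coef_wide _ sr) mulr_sumr; apply: eq_bigr => i _.
  have -> : t ^+ n = t ^+ i * t ^+ (n - i) by rewrite -exprD subnKC // -ltnS.
  by rewrite expr_div_n; field; rewrite expf_neq0.
have sp : (size p <= n.+1)%N by rewrite -sn leq_maxl.
have sq : (size q <= n.+1)%N by rewrite -sn leq_maxr.
have rt (r : {poly k}) : (size r <= n.+1)%N -> form n r s t = 0 -> root r (s / t).
  move=> sr; rewrite f1 // => /eqP; rewrite mulf_eq0 expf_eq0 (negPf nt) andbF /=.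
  by move=> r0; rewrite /root.
by have := coprimep_root cop (rt _ sp fp); rewrite -/(root _ _) (rt _ sq fq).
Qed.

Lemma horner_form_poly n p a b z : (form_poly n p a b).[z] = form n p a.[z] b.[z].
Proof.
rewrite /form_poly horner_sum; apply: eq_bigr => i _.
by rewrite hornerZ hornerM !horner_exp mulrA.
Qed.

Lemma coefM_top (p q : {poly k}) m n : (size p <= m.+1)%N -> (size q <= n.+1)%N ->
  (size (p * q)%R <= (m + n).+1)%N /\ (p * q)`_(m + n) = p`_m * q`_n.
Proof.
move=> sp sq; split.
  by apply: leq_trans (size_polyMleq _ _) _; lia.
rewrite coefM (bigD1 (Ordinal (leq_addr n m : m < (m + n).+1)%N)) //= addKn big1 ?addr0 // => i ni.
have [lt|ge] := ltnP i m.
  by rewrite [q`_ _]nth_default ?mulr0 //; apply: leq_trans sq _; lia.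
rewrite nth_default ?mul0r //; apply: leq_trans sp _.
by rewrite ltn_neqAle ge andbT eq_sym; apply: contra ni => /eqP im; apply/eqP/val_inj.
Qed.

Lemma coefX_top (p : {poly k}) m i : (size p <= m.+1)%N ->
  (size (p ^+ i)%R <= (i * m).+1)%N /\ (p ^+ i)`_(i * m) = p`_m ^+ i.
Proof.
move=> sp; elim: i => [|i [s1 c1]]; first by rewrite !expr0 size_poly1 coef1.
have [s2 c2] := coefM_top sp s1.
by rewrite !exprS mulSn; split; rewrite // c2 c1.
Qed.

Lemma coef_form_poly n (p a b : {poly k}) d : (size a <= d.+1)%N -> (size b <= d.+1)%N ->
  (form_poly n p a b)`_(n * d) = form n p a`_d b`_d.
Proof.
move=> sa sb; rewrite /form_poly coef_sum; apply: eq_bigr => i _.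
have [s1 c1] := coefX_top i sa; have [s2 c2] := coefX_top (n - i) sb.
have [_ c3] := coefM_top s1 s2.
have -> : (n * d = i * d + (n - i) * d)%N by rewrite -mulnDl subnKC // -ltnS.
by rewrite coefZ c3 c1 c2 mulrA.
Qed.

(* The degree of f o A is deg f * deg A, while that of al * f + be is at most deg f. *)
Lemma composite_not_affine (h : {rmorphism ratfun k -> ratfun k}) A f al be :
  (1 < rat_degree A)%N -> (forall a, h (rat_const a) = rat_const a) -> h (tofrac 'X) = A ->
  h f = rat_const al * f + rat_const be -> exists a, f = rat_const a.
Proof.
move=> dA hC hX hf; apply: contrapT => nf.
have [a [b [cab nb AE dAE]]] := rat_repr A.
have [p [q [cpq nq fE _]]] := rat_repr f.
have sm : (0 < maxn (size p) (size q))%N by rewrite leq_max !size_poly_gt0 nq orbT.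
set n := (maxn (size p) (size q)).-1.
have mE : maxn (size p) (size q) = n.+1 by rewrite prednK.
have sp : (size p <= n.+1)%N by rewrite -mE leq_maxl.
have sq : (size q <= n.+1)%N by rewrite -mE leq_maxr.
have n0 : (0 < n)%N.
  rewrite lt0n; apply/eqP => n0; rewrite n0 in sp sq.
  apply: nf; exists (p`_0 / q`_0).
  by rewrite fE fmorph_div [in LHS](size1_polyC sp) [in LHS](size1_polyC sq).
set d := (maxn (size a) (size b)).-1 in dAE.
have sab : (0 < maxn (size a) (size b))%N by rewrite leq_max !size_poly_gt0 nb orbT.
have dE : maxn (size a) (size b) = d.+1 by rewrite prednK.
have sa : (size a <= d.+1)%N by rewrite -dE leq_maxl.
have sb : (size b <= d.+1)%N by rewrite -dE leq_maxr.
have d2 : (1 < d)%N by rewrite -dAE.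
have ntb : tofrac b != 0 by rewrite tofrac_eq0.
have hp (r : {poly k}) : (size r <= n.+1)%N ->
    h (tofrac r) = tofrac (form_poly n r a b) / tofrac b ^+ n.
  move=> sr; rewrite -pev_rat_const rmorph_pev (eq_pev _ _ (hC : h \o rat_const =1 rat_const)).
  rewrite hX pevE (@horner_coef_wide _ n.+1) ?size_map_poly // /form_poly rmorph_sum mulr_suml.
  apply: eq_bigr => i _; rewrite coef_map -mul_polyC !rmorphM !rmorphXn /=.
  have -> : tofrac b ^+ n = tofrac b ^+ i * tofrac b ^+ (n - i).
    by rewrite -exprD subnKC // -ltnS.
  by rewrite AE; exact: homogenize_term.
set P := form_poly n p a b; set Q := form_poly n q a b.
have cPQ : coprimep P Q.
  rewrite /coprimep; apply: contraT => /closed_rootP[z].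
  rewrite root_gcd /root !horner_form_poly => /andP[/eqP Pz /eqP Qz].
  have [az bz] := form_common_zero cpq mE Pz Qz.
  by have := coprimep_root cab (_ : root a z); rewrite /root az bz eqxx => /(_ isT).
have hq0 : h (tofrac q) != 0 by rewrite fmorph_eq0 tofrac_eq0.
have nQ : Q != 0 by apply: contraNneq hq0 => Q0; rewrite hp // -/Q Q0 rmorph0 mul0r.
set R := al *: p + be *: q.
have PqRQ : P * q = R * Q.
  apply/eqP; rewrite -tofrac_eq !rmorphM /=; apply/eqP.
  move: hf; rewrite {1}fE fmorph_div /= !hp // -/P -/Q.
  have tR : tofrac R = rat_const al * tofrac p + rat_const be * tofrac q.
    by rewrite /R -!mul_polyC rmorphD !rmorphM.
  have tq : tofrac q != 0 by rewrite tofrac_eq0.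
  have tQ : tofrac Q != 0 by rewrite tofrac_eq0.
  have nbn : tofrac b ^+ n != 0 by rewrite expf_eq0 negb_and ntb orbT.
  rewrite tR => e1.
  have {}e1 : tofrac P / tofrac b ^+ n / (tofrac Q / tofrac b ^+ n) =
      rat_const al * (tofrac p / tofrac q) + rat_const be by rewrite -[tofrac p / _]fE.
  exact: (@affine_cross _ (tofrac P) (tofrac Q) (tofrac b ^+ n) (tofrac p) (tofrac q)
    (rat_const al) (rat_const be) tQ nbn tq e1).
have nR : R != 0.
  apply/eqP => R0; move/eqP: PqRQ; rewrite R0 mul0r mulf_eq0 (negPf nq) orbF => /eqP P0.
  have : h (tofrac p) = 0 by rewrite hp // -/P P0 rmorph0 mul0r.
  move/eqP; rewrite fmorph_eq0 tofrac_eq0 => /eqP p0.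
  by apply: nf; exists 0; rewrite fE p0 !rmorph0 mul0r.
have sR : (size R <= n.+1)%N.
  by rewrite (leq_trans (size_polyD _ _)) // geq_max !(leq_trans (size_scale_leq _ _)).
have sP : (size P <= n.+1)%N.
  apply: leq_trans sR; apply: dvdp_leq => //.
  by rewrite -(Gauss_dvdpl _ cPQ) -PqRQ dvdp_mulr.
have sQ : (size Q <= n.+1)%N.
  apply: leq_trans sq; apply: dvdp_leq => //.
  by rewrite -(Gauss_dvdpr _ (_ : coprimep Q P)) ?PqRQ ?dvdp_mull // coprimep_sym.
have nd : (n.+1 <= n * d)%N by nia.
have P0 : form n p a`_d b`_d = 0.
  by rewrite -coef_form_poly // nth_default // (leq_trans sP).
have Q0 : form n q a`_d b`_d = 0.
  by rewrite -coef_form_poly // nth_default // (leq_trans sQ).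
have [ad bd] := form_common_zero cpq mE P0 Q0.
case: (leqP (size a) (size b)) => [ab|/ltnW ab].
  have sbd : size b = d.+1 by rewrite -dE (maxn_idPr ab).
  by move: bd => /eqP; rewrite -[d]/(d.+1.-1) -sbd -lead_coefE lead_coef_eq0 -size_poly_eq0 sbd.
have sad : size a = d.+1 by rewrite -dE (maxn_idPl ab).
by move: ad => /eqP; rewrite -[d]/(d.+1.-1) -sad -lead_coefE lead_coef_eq0 -size_poly_eq0 sad.
Qed.
End DegreeOfComposite.

(** * Extension of embeddings *)

Lemma root_of_split_divisor (M : fieldType) (rs : seq M) p q :
  p %| q -> q %= \prod_(b <- rs) ('X - b%:P) -> size p != 1 -> exists b, root p b.
Proof.
move=> pq qE sp; have : p %| \prod_(b <- rs) ('X - b%:P) by rewrite -(eqp_dvdr _ qE).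
move=> /(dvdp_prod_XsubC (F := id))[m pm].
case E : (mask m rs) pm => [|b s] pm.
  by move: sp; rewrite (eqp_size pm) big_nil size_poly1.
by exists b; rewrite (eqp_root pm) big_cons rootM root_XsubC eqxx.
Qed.

Section Embedding.
Variables (K : fieldType) (L : fieldExtType K) (M : fieldType).

Lemma embedding_adjoin (E : {subfield L}) (s : {rmorphism subvs_of E -> M}) r nu r' :
  map_poly vsval nu = minPoly E r -> root (map_poly s nu) r' ->
  exists s' : {rmorphism subvs_of <<E; r>>%AS -> M},
    forall u v, vsval u = vsval v -> s' u = s v.
Proof.
move=> nuE r'0; pose Er := <<E; r>>%AS.
have memEr (Q : {poly subvs_of E}) : pev (vsval : subvs_of E -> L) r Q \in Er.
  by apply: mempx_Fadjoin; apply/polyOver_subvs; exists Q.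
pose ev (Q : {poly subvs_of E}) : subvs_of Er := vsproj Er (pev (vsval : subvs_of E -> L) r Q).
have evE Q : vsval (ev Q) = pev (vsval : subvs_of E -> L) r Q.
  exact: vsprojK (memEr Q).
have evB : zmod_morphism ev by move=> P Q; rewrite /ev rmorphB /= raddfB.
have evM : monoid_morphism ev.
  split=> [|P Q]; apply: (can_inj vsvalK); rewrite evE.
    by rewrite rmorph1 (rmorph1 (@vsval _ _ Er)).
  by rewrite rmorphM (rmorphM (@vsval _ _ Er)) /= !evE.
pose ev1 := GRing.isZmodMorphism.Build _ _ ev evB.
pose ev2 := GRing.isMonoidMorphism.Build _ _ ev evM.
pose evR : {rmorphism {poly subvs_of E} -> subvs_of Er} := HB.pack ev ev1 ev2.
have ev_surj u : exists Q, u = evR Q.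
  have /Fadjoin_polyP[p /polyOver_subvs[Q ->] uE] := subvsP u.
  by exists Q; apply: val_inj; rewrite /= evE.
have ker Q : evR Q = 0 -> pev s r' Q = 0.
  move=> /(congr1 vsval); rewrite /= evE => Qr.
  have /dvdpP[T ->] : nu %| Q.
    rewrite -(dvdp_map vsval) nuE; apply: minPoly_dvdp; last exact/rootP.
    by apply/polyOver_subvs; exists Q.
  by rewrite rmorphM /= [pev s r' nu]pevE (rootP r'0) mulr0.
have [|Q|s' s'E] := @rmorphism_factor _ _ evR _ M (pev s r').
- by move=> u; have [Q ->] := ev_surj u; exists Q, 1; rewrite rmorph1 oner_neq0 divr1.
- apply/eqP/eqP => [sQ|]; last exact: ker.
  apply/eqP; apply: contraT => nQ; have [Q' Q'E] := ev_surj (evR Q)^-1.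
  have : pev s r' (Q * Q' - 1) = 0.
    by apply: ker; rewrite rmorphB rmorphM rmorph1 -Q'E divff ?subrr.
  by rewrite rmorphB rmorphM rmorph1 /= sQ mul0r sub0r => /eqP; rewrite oppr_eq0 oner_eq0.
exists s' => u v uv; have -> : u = evR v%:P.
  by apply: val_inj; rewrite /= evE pevC.
by rewrite s'E /= pevC.
Qed.

Variables (sg : {rmorphism K -> M}) (mu : {poly K}) (rs' : seq M).
Hypothesis mu_split : map_poly sg mu %= \prod_(b <- rs') ('X - b%:P).

Lemma embedding_adjoin_seq (rs : seq L) (E : {subfield L}) (s : {rmorphism subvs_of E -> M}) :
  (forall r, r \in rs -> root (map_poly (in_alg L) mu) r) -> (forall a, s a%:A = sg a) ->
  exists (E' : {subfield L}) (s' : {rmorphism subvs_of E' -> M}),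
    [/\ (E <= E')%VS, {subset rs <= E'} & forall a, s' a%:A = sg a].
Proof.
elim: rs E s => [|r rs IH] E s rt sE; first by exists E, s; split=> // r.
have [nu nuE] : exists nu : {poly subvs_of E}, minPoly E r = map_poly vsval nu.
  by apply/polyOver_subvs; exact: minPolyOver.
have rr : root (map_poly (in_alg L) mu) r by apply: rt; rewrite inE eqxx.
have nu_mu : nu %| map_poly (in_alg (subvs_of E)) mu.
  rewrite -(dvdp_map vsval) -nuE -map_poly_comp.
  have -> : map_poly (vsval \o in_alg (subvs_of E)) mu = map_poly (in_alg L) mu.
    by apply: eq_map_poly => a /=; rewrite algid1.
  by apply: minPoly_dvdp => //; exact: alg_polyOver.
have : map_poly s nu %| map_poly sg mu.
  rewrite (_ : map_poly sg mu = map_poly s (map_poly (in_alg (subvs_of E)) mu)) ?dvdp_map //.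
  by rewrite -map_poly_comp; apply: eq_map_poly => a /=; rewrite sE.
move=> /root_of_split_divisor /(_ mu_split)[|r' r'0].
  rewrite size_map_poly -(size_map_poly vsval) -nuE size_minPoly.
  by rewrite eqSS -lt0n adjoin_degreeE divn_gt0 ?adim_gt0 // dimvS ?subv_adjoin.
have [s1 s1E] := embedding_adjoin (esym nuE) r'0.
have [||E' [s' [sE' rsE' s'E]]] := IH <<E; r>>%AS s1.
- by move=> b brs; apply: rt; rewrite inE brs orbT.
- by move=> a; rewrite (s1E _ a%:A) ?sE //= !algid1.
exists E', s'; split=> //; first exact: subv_trans (subv_adjoin _ _) sE'.
move=> b; rewrite inE => /orP[/eqP->|]; last exact: rsE'.
by apply: (subvP sE'); exact: memv_adjoin.
Qed.

Lemma embedding_extends (rs : seq L) : map_poly (in_alg L) mu %= \prod_(r <- rs) ('X - r%:P) ->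
  <<1 & rs>>%VS = fullv -> exists s : {rmorphism L -> M}, forall a, s a%:A = sg a.
Proof.
move=> muE genL.
have [|a|s0 s0E] := @rmorphism_factor _ _ (in_alg (subvs_of (1%AS : {subfield L}))) _ M sg.
- move=> u; have /vlineP[a uE] := subvsP u; exists a, 1.
  by rewrite rmorph1 oner_neq0 divr1; split=> //; apply: val_inj; rewrite /= uE algid1.
- by rewrite !fmorph_eq0.
have [||E [s [_ rsE sE]]] := embedding_adjoin_seq (rs := rs) (s := s0).
- by move=> r rrs; rewrite (eqp_root muE) root_prod_XsubC.
- by move=> a; rewrite -s0E.
have fullE u : u \in E.
  have : (<<1 & rs>> <= E)%VS by apply/Fadjoin_seqP; split=> //; exact: sub1v.
  by move=> /subvP; apply; rewrite genL memvf.
pose f u := s (vsproj E u).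
have fB : zmod_morphism f by move=> u v; rewrite /f raddfB /= rmorphB.
have fM : monoid_morphism f.
  split=> [|u v]; rewrite /f.
    by rewrite -(rmorph1 s); congr (s _); apply: val_inj; rewrite /= vsprojK // algid1.
  by rewrite -rmorphM; congr (s _); apply: val_inj; rewrite /= !vsprojK.
pose f1 := GRing.isZmodMorphism.Build _ _ f fB.
pose f2 := GRing.isMonoidMorphism.Build _ _ f fM.
pose fR : {rmorphism L -> M} := HB.pack f f1 f2.
exists fR => a; rewrite /= /f -sE; congr (s _); apply: val_inj.
by rewrite /= vsprojK // algid1.
Qed.
End Embedding.

Section AffineCoefficient.
Variables (k : closedFieldType) (K : fieldType) (c : {rmorphism k -> K}).
Variables (L : fieldExtType K) (e : {rmorphism k -> L}).
Hypothesis eE : forall a, e a = (c a)%:A.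

(* g is the first nonconstant coefficient of the minimal polynomial of u; the one of
   f u = a u + b can be computed both by applying f and by substitution. *)
Lemma affine_coefficient (f : {rmorphism L -> L}) u a b :
  (forall a, f (e a) = e a) -> (forall g : K, f g%:A \in 1%VS) ->
  (forall a, u != e a) -> f u = e a * u + e b ->
  exists g : K, (forall a, g != c a) /\
    exists al be, f g%:A = e al * g%:A + e be.
Proof.
move=> fe fK nu fu.
have [P Pmin] : exists P : {poly K}, minPoly 1 u = map_poly (in_alg L) P.
  by apply/polyOver1P; exact: minPolyOver.
have nP : P != 0.
  by apply: contraTneq (monic_neq0 (monic_minPoly 1 u)) => P0; rewrite Pmin P0 map_poly0 eqxx.
have mP := monic_minPoly 1 u.
pose nonconst i := `[< forall a, P`_i != c a >].
have [i0 ni0] : exists i, nonconst i.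
  apply: contrapT => /forallNP H.
  have /choice[p pE] : forall i, exists a, P`_i = c a.
    move=> i; apply: contrapT => /forallNP Hi; apply: (H i); apply/asboolP => a'.
    by apply/eqP; exact: Hi.
  pose q : {poly k} := \poly_(i < size P) p i.
  have qP : map_poly c q = P.
    apply/polyP => i; rewrite coef_map coef_poly; case: ltnP => [_|ge].
      exact: esym (pE i).
    by rewrite [RHS]nth_default //; exact: rmorph0.
  have qu : pev e u q = 0.
    rewrite pevE -(minPolyxx 1 u) Pmin -qP -map_poly_comp.
    by congr (_.[_]); apply: eq_map_poly => a' /=; rewrite eE.
  have /eqP q0 := closed_transcendental nu qu.
  by move: nP; rewrite -qP map_poly_eq0 q0.
have bound i : nonconst i -> (i <= size P)%N.
  move=> /asboolP ni; rewrite leqNgt; apply/negP => lt.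
  by have /eqP := ni 0; rewrite rmorph0; apply; rewrite nth_default // ltnW.
have [i /asboolP ni imax] := ex_maxnP (ex_intro _ i0 ni0) bound.
have na : a != 0.
  apply/eqP => a0; move: fu; rewrite a0 rmorph0 mul0r add0r -(fe b) => /fmorph_inj ub.
  by have := nu b; rewrite ub eqxx.
pose l : {poly k} := a *: 'X + b%:P.
have sl : size l = 2.
  by rewrite /l size_polyDl ?size_scale ?size_polyX // size_polyC; case: (b != 0).
pose le := map_poly e l.
have leE : le = (e a) *: 'X + (e b)%:P by rewrite /le rmorphD /= map_polyZ map_polyX map_polyC.
pose Q := map_poly f (minPoly 1 u) \Po le.
have Qu : Q.[u] = 0.
  rewrite /Q horner_comp leE hornerD hornerZ hornerX hornerC -fu horner_map /=.
  by rewrite minPolyxx rmorph0.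
have over1 a' : e a' \in 1%VS by rewrite eE rpredZ // rpred1.
have Q1 : Q \is a polyOver 1%VS.
  apply: polyOver_comp; last first.
    by apply/polyOverP => m; rewrite coef_map; exact: over1.
  by apply/polyOverP => m; rewrite coef_map Pmin coef_map; exact: fK.
have sQ : size Q = size (minPoly 1 u).
  by rewrite size_comp_poly2 ?size_map_poly.
have : minPoly 1 u %= Q.
  by rewrite -dvdp_size_eqp ?sQ // minPoly_dvdp //; apply/rootP.
rewrite eqp_sym => /eqpf_eq[ga nga QE].
have gaE : ga = e (a ^+ (size (minPoly 1 u)).-1).
  have := lead_coefZ ga (minPoly 1 u); rewrite -QE (monicP mP) mulr1 => <-.
  rewrite lead_coef_comp ?size_map_poly ?sl // !lead_coef_map (monicP mP) rmorph1 mul1r.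
  rewrite rmorphXn ?size_map_poly /=; congr (e _ ^+ _).
  by rewrite lead_coefE sl coefD coefZ coefX coefC mulr1 addr0.
exists P`_i; split=> //.
have sl2 : (size l <= 2)%N by rewrite sl.
have lj j : (size (l ^+ j)%R <= j.+1)%N /\ (l ^+ j)`_j = a ^+ j.
  have := coefX_top j sl2; rewrite muln1 => -[s1 ->]; split=> //.
  by rewrite coefD coefZ coefX coefC mulr1 addr0.
have pex m : exists a', (i < m)%N -> P`_m = c a'.
  have [lt|ge] := ltnP i m; last by exists 0.
  have : ~ nonconst m by move=> /imax; lia.
  move=> H; apply: contrapT => /forallNP H'; apply: H; apply/asboolP => a'.
  by apply/eqP => pa'; apply: (H' a').
have [p pE] := choice pex.
have coefE' : Q`_i = f (P`_i)%:A * e (a ^+ i) +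
    e (\sum_(j < size P | (i < j)%N) p j * (l ^+ j)`_i).
  have -> : Q`_i = \sum_(j < size P) f (P`_j)%:A * e (l ^+ j)`_i.
    rewrite /Q Pmin comp_polyE !size_map_poly coef_sum; apply: eq_bigr => j _.
    by rewrite coefZ !coef_map /= /le -rmorphXn coef_map.
  have ltiP : (i < size P)%N.
    rewrite ltnNge; apply/negP => ge; have /eqP := ni 0.
    by rewrite rmorph0; apply; exact: nth_default.
  rewrite (bigID (fun j : 'I_(size P) => (i < j)%N)) /= addrC; congr (_ + _); last first.
    rewrite rmorph_sum; apply: eq_bigr => j ij.
    by rewrite pE // -eE fe rmorphM.
  rewrite (bigD1 (Ordinal ltiP)) ?ltnn //= (lj i).2 big1 ?addr0 // => j /andP[ji nj].
  rewrite [(l ^+ j)`_i]nth_default ?rmorph0 ?mulr0 //.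
  apply: leq_trans (lj j).1 _; move: ji; rewrite -leqNgt => ji.
  by rewrite ltn_neqAle ji andbT; apply: contra nj => /eqP ij; apply/eqP/val_inj.
set be := \sum_(j < _ | _) _ in coefE'.
exists (a ^+ (size (minPoly 1 u)).-1 / a ^+ i), (- be / a ^+ i).
have nai : e (a ^+ i) != 0 by rewrite fmorph_eq0 expf_neq0.
move: coefE'; rewrite QE coefZ gaE Pmin coef_map /= => coefE'.
apply: (mulIf nai); rewrite mulrDl mulrAC !fmorph_div divfK // rmorphN divfK //.
by rewrite coefE'; ring.
Qed.
End AffineCoefficient.

(** * Semiconjugate rational functions *)

Section GeneratedSubfield.
Variables (F : fieldType) (S : set F).

Lemma gen_subfield_sub (T : set F) : divring_closed [in T] -> S `<=` T ->
  gen_subfield S `<=` T.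
Proof. by move=> dT ST f; apply. Qed.

Lemma sub_gen_subfield : S `<=` gen_subfield S.
Proof. by move=> f Sf T [_]; apply. Qed.

Lemma gen_field_of f : gen_subfield S f -> exists u : gen_field S, val u = f.
Proof. by move=> /mem_set Sf; exists (GenField Sf). Qed.

Lemma gen_field_ind (T : set (gen_field S)) : divring_closed [in T] ->
  (forall u, S (val u) -> T u) -> forall u, T u.
Proof.
move=> [T1 TB TD] ST u; pose M := [set f | exists2 v, T v & val v = f].
suff [v Tv /val_inj <-] : M (val u) by [].
apply: (@gen_subfield_sub M); last by have := valP u; rewrite /gen_pred inE.
  split=> [|_ _ /set_mem[a Ta <-] /set_mem[b Tb <-]|_ _ /set_mem[a Ta <-] /set_mem[b Tb <-]].
  - by apply/mem_set; exists 1; [exact/set_mem|].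
  - apply/mem_set; exists (a - b); last by rewrite rmorphB.
    by apply/set_mem/TB; exact/mem_set.
  - apply/mem_set; exists (a / b); last by rewrite fmorph_div.
    by apply/set_mem/TD; exact/mem_set.
move=> f Sf; have [v vf] := gen_field_of (sub_gen_subfield Sf).
by exists v => //; apply: ST; rewrite vf.
Qed.
End GeneratedSubfield.

Lemma ratfun_rmorph_eq (k F : fieldType) (f g : {rmorphism ratfun k -> F}) :
  (forall a, f (rat_const _ a) = g (rat_const _ a)) ->
  f (FracField.tofrac 'X) = g (FracField.tofrac 'X) -> f =1 g.
Proof.
move=> fgC fgX h; rewrite [h]fraction_repr !fmorph_div.
have fg (p : {poly k}) : f (FracField.tofrac p) = g (FracField.tofrac p).
  rewrite -pev_rat_const !rmorph_pev fgX; apply: eq_pev => a; exact: fgC.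
by rewrite !fg.
Qed.

Lemma ratfun_mem (k K : fieldType) (L : fieldExtType K) (j : {rmorphism ratfun k -> L})
    (E : {subfield L}) : (forall a, j (rat_const _ a) \in E) ->
  j (FracField.tofrac 'X) \in E -> forall f, j f \in E.
Proof.
move=> jC jX f; rewrite [f]fraction_repr fmorph_div.
have jp (p : {poly k}) : j (FracField.tofrac p) \in E.
  rewrite -pev_rat_const rmorph_pev pevE rpred_horner //; apply/polyOverP => i.
  by rewrite coef_map; exact: jC.
by rewrite rpred_div.
Qed.

Lemma gen_field_over_const (k : fieldType) (X : ratfun k) :
  let K := gen_field (over_const [set X]) in
  exists (c : {rmorphism k -> K}) (x : K), [/\ forall a, val (c a) = rat_const k a, val x = X
    & forall T : set K, divring_closed [in T] -> (forall a, T (c a)) -> T x -> forall u, T u].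
Proof.
move=> K; pose valK : {rmorphism K -> ratfun k} := val.
have c0ex a : exists u : K, val u = rat_const k a.
  by apply: gen_field_of; apply: sub_gen_subfield; left; exists a.
have [c0 c0E] := choice c0ex.
have c0B : zmod_morphism c0.
  by move=> a b; apply: val_inj; rewrite (rmorphB valK) /= !c0E rmorphB.
have c0M : monoid_morphism c0.
  split=> [|a b]; apply: val_inj; first by rewrite (rmorph1 valK) c0E rmorph1.
  by rewrite (rmorphM valK) /= !c0E rmorphM.
pose c1 := GRing.isZmodMorphism.Build _ _ c0 c0B.
pose c2 := GRing.isMonoidMorphism.Build _ _ c0 c0M.
pose c : {rmorphism k -> K} := HB.pack c0 c1 c2.
have [x xE] : exists x : K, val x = X.
  by apply: gen_field_of; apply: sub_gen_subfield; right.
exists c, x; split=> // T dT Tc Tx; apply: gen_field_ind dT _ => u [[a _ ua]|uX].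
  by have -> : u = c a by apply: val_inj; rewrite /= c0E.
by have -> : u = x by apply: val_inj; rewrite xE.
Qed.

Lemma gen_field_image (k : fieldType) (X : ratfun k) (f : {rmorphism ratfun k -> ratfun k}) :
  let K := gen_field (over_const [set X]) in
  (forall a, f (rat_const k a) = rat_const k a) -> (exists u' : K, val u' = f X) ->
  forall u : K, exists u' : K, val u' = f (val u).
Proof.
move=> K fC fX; pose valK : {rmorphism K -> ratfun k} := val.
have [c [x [cE xE x_gen]]] := gen_field_over_const X.
apply: (x_gen [set v : K | exists u' : K, val u' = f (val v)]) => [|a|].
- split=> [|u v /set_mem[u' uu'] /set_mem[v' vv']|u v /set_mem[u' uu'] /set_mem[v' vv']];
    apply/mem_set.
  + by exists 1; rewrite !rmorph1.
  + by exists (u' - v'); rewrite !(rmorphB valK) /= uu' vv' rmorphB.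
  + by exists (u' / v'); rewrite !(fmorph_div valK) /= uu' vv' fmorph_div.
- by exists (c a); rewrite cE fC.
suff : exists u' : K, val u' = f (val x) by [].
by rewrite xE.
Qed.

Lemma composition_image (k : fieldType) (X : ratfun k) (h : {rmorphism ratfun k -> ratfun k}) :
  let K := gen_field (over_const [set X]) in
  (forall p, h (FracField.tofrac p) = pev (rat_const k) X p) ->
  (forall f, exists u : K, val u = h f) /\ (forall u : K, exists f, h f = val u).
Proof.
move=> K hp; pose valK : {rmorphism K -> ratfun k} := val.
have [c [x [cE xE x_gen]]] := gen_field_over_const X.
split=> [f|].
  exists (pev c x \n_(repr f) / pev c x \d_(repr f)).
  rewrite {3}[f]fraction_repr (fmorph_div valK) (fmorph_div h) !hp !rmorph_pev /= xE.
  by rewrite !(eq_pev _ _ (cE : valK \o c =1 rat_const k)).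
apply: (x_gen [set v : K | exists f, h f = val v]) => [|a|].
- split=> [|u v /set_mem[f fu] /set_mem[g gv]|u v /set_mem[f fu] /set_mem[g gv]];
    apply/mem_set.
  + by exists 1; rewrite !rmorph1.
  + by exists (f - g); rewrite (rmorphB valK) /= -fu -gv rmorphB.
  + by exists (f / g); rewrite (fmorph_div valK) /= -fu -gv fmorph_div.
- by exists (FracField.tofrac a%:P); rewrite hp pevC cE.
by exists (FracField.tofrac 'X); rewrite hp pevX xE.
Qed.

Section SemiconjugacyLift.
Variables (k : fieldType) (B X : ratfun k).
Notation K := (gen_field (over_const [set X])).
Variables (L : splittingFieldType K) (j : {rmorphism ratfun k -> L}).
Hypothesis Lclosure : galois_closure j.
Hypothesis genBX : gen_subfield (over_const [set B; X]) = setT.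
Variable f : {rmorphism ratfun k -> ratfun k}.
Hypothesis fz : f (FracField.tofrac 'X) = B.
Hypothesis fK : forall u : K, exists u' : K, val u' = f (val u).
Notation z := (FracField.tofrac ('X : {poly k})).

Let jK (u : K) : j (val u) = u%:A. Proof. by have [] := Lclosure. Qed.

Lemma j_base (E : {subfield L}) (u : K) : j (val u) \in E.
Proof. by rewrite jK rpredZ // rpred1. Qed.

Lemma j_const (E : {subfield L}) a : j (rat_const k a) \in E.
Proof.
have [u <-] : exists u : K, val u = rat_const k a.
  by apply: gen_field_of; apply: sub_gen_subfield; left; exists a.
exact: j_base.
Qed.

Lemma adjoin_B : <<1; j B>>%VS = <<1; j z>>%VS.
Proof.
have jB g : j g \in <<1; j B>>%VS.
  suff : [set g | j g \in <<1; j B>>%VS] g by [].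
  apply: (@gen_subfield_sub _ (over_const [set B; X])); last by rewrite genBX.
    split=> [|u v /set_mem ju /set_mem jv|u v /set_mem ju /set_mem jv]; apply/mem_set => /=.
    - by rewrite rmorph1 rpred1.
    - by rewrite rmorphB rpredB.
    - by rewrite fmorph_div rpred_div.
  move=> _ [[a _ <-]|[->|->]] /=; first exact: (j_const <<1; j B>>%AS).
    exact: memv_adjoin.
  have [u uX] : exists u : K, val u = X.
    by apply: gen_field_of; apply: sub_gen_subfield; right.
  by have := j_base <<1; j B>>%AS u; rewrite uX.
apply/eqP; rewrite eqEsubv; apply/andP; split; apply/FadjoinP; split=> //.
- exact: subv_adjoin.
- apply: (@ratfun_mem _ _ _ j <<1; j z>>%AS); last exact: memv_adjoin.
  exact: j_const.
- exact: subv_adjoin.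
Qed.

(* Since k(B, X) = k(z), applying f to the minimal polynomial of z over k(X) yields the
   minimal polynomial of B, which splits in L. *)
Lemma lift_exists : exists phi : {rmorphism L -> L}, forall u : K, phi u%:A = j (f (val u)).
Proof.
have [_ galL Lmin] := Lclosure.
pose valK : {rmorphism K -> ratfun k} := val.
pose sg : {rmorphism K -> L} := j \o f \o valK.
have [mu muE] : exists mu : {poly K}, minPoly 1 (j z) = map_poly (in_alg L) mu.
  by apply/polyOver1P; exact: minPolyOver.
have sgmu1 : map_poly sg mu \is a polyOver 1%VS.
  apply/polyOverP => i; rewrite coef_map /=; have [u' <-] := fK mu`_i.
  exact: (j_base 1%AS).
have mu_z : pev valK z mu = 0.
  apply: (fmorph_inj j); rewrite rmorph0 rmorph_pev -(minPolyxx 1 (j z)) muE pevE.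
  by congr (_.[_]); apply: eq_map_poly => a /=; rewrite jK.
have sgmu_B : root (map_poly sg mu) (j B).
  apply/rootP; have := congr1 (j \o f) mu_z; rewrite /= !rmorph0 !rmorph_pev /= fz pevE => <-.
  by congr (_.[_]); apply: eq_map_poly.
have sizes : size (map_poly sg mu) = size (minPoly 1 (j B)).
  rewrite size_map_poly -(size_map_poly (in_alg L)) -muE !size_minPoly.
  by rewrite !adjoin_degreeE adjoin_B.
have [rs' /eqP rs'E] := splitting_field_normal 1%AS (j B).
have mu_split : map_poly sg mu %= \prod_(b <- rs') ('X - b%:P).
  by rewrite -rs'E eqp_sym -dvdp_size_eqp ?sizes // minPoly_dvdp.
have [rs /eqP rsE] := splitting_field_normal 1%AS (j z).
have mu_rs : map_poly (in_alg L) mu %= \prod_(r <- rs) ('X - r%:P) by rewrite -muE rsE eqpxx.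
have genL : <<1 & rs>>%VS = fullv.
  apply: (Lmin <<1 & rs>>%AS).
    apply/splitting_galoisField; exists (minPoly 1 (j z)); split.
    - exact: minPolyOver.
    - have /and3P[_ /separableP sepL _] := galL.
      by apply: sepL; exact: memvf.
    - by exists rs => //; rewrite rsE eqpxx.
  apply: ratfun_mem; first exact: j_const.
  by apply: seqv_sub_adjoin; rewrite -root_prod_XsubC -rsE root_minPoly.
by have [phi phiE] := embedding_extends mu_split mu_rs genL; exists phi.
Qed.
End SemiconjugacyLift.

Lemma semiconjugate_genus (k : closedFieldType) (A B X : ratfun k) :
  [pchar k] =i pred0 -> (2 <= rat_degree A)%N -> (2 <= rat_degree B)%N ->
  (2 <= rat_degree X)%N -> rat_comp A X = rat_comp X B ->
  gen_subfield (over_const [set B; X]) = setT ->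
  forall (L : splittingFieldType (gen_field (over_const [set X])))
    (j : {rmorphism ratfun k -> L}), galois_closure j ->
  has_genus (j \o rat_const k) 0 \/ has_genus (j \o rat_const k) 1.
Proof.
move=> char0 degA degB degX AX_XB genBX L j Lclosure.
have transc (f : ratfun k) : (1 < rat_degree f)%N -> transcendental (rat_const k) f.
  move=> df; apply: closed_transcendental => a; apply: rat_nonconstant; exact: ltnW.
have [hA [hAC hAz _ hAE]] := composition_rmorphism (transc A degA).
have [hB [hBC hBz _ hBE]] := composition_rmorphism (transc B degB).
have [hX [hXC hXz hXp hXE]] := composition_rmorphism (transc X degX).
have AX : hX A = hB X by rewrite hXE hBE.
have [jK galL _] := Lclosure.
have [c [x [cE xE x_gen]]] := gen_field_over_const X.
have [hX_K K_hX] := composition_image hXp.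
have hB_K : forall u : gen_field (over_const [set X]), exists u' : gen_field (over_const [set X]),
    val u' = hB (val u).
  by apply: gen_field_image => //; have [u uE] := hX_K A; exists u; rewrite uE.
have x_transc : transcendental c x.
  move=> p px; apply: (transc X degX).
  have := congr1 (val : _ -> ratfun k) px; rewrite rmorph_pev rmorph0 /= xE => <-.
  by apply: eq_pev => a /=; rewrite cE.
pose e : {rmorphism k -> L} := j \o rat_const k.
have eE a : e a = (c a)%:A by rewrite -jK cE.
have [phi phiE] := lift_exists Lclosure genBX hBz hB_K.
have phi_e a : phi (e a) = e a by rewrite eE phiE cE hBC -jK cE.
case: (genus_or_affine char0 x_transc x_gen galL eE phi_e) => [g0|[g1|]]; [by left|by right|].
case=> u [nu [a [b phi_u]]]; exfalso.
have phiK g : phi g%:A \in 1%VS.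
  by rewrite phiE; have [u' <-] := hB_K g; exact: (j_base Lclosure 1%AS).
have [g [ng [al [be gE]]]] := affine_coefficient eE phi_e phiK nu phi_u.
have [h hE] := K_hX g.
have hBX : hB \o hX =1 hX \o hA.
  apply: ratfun_rmorph_eq => [a'|] /=; first by rewrite !(hXC, hAC, hBC).
  by rewrite hXz hAz AX.
have hAh : hA h = rat_const k al * h + rat_const k be.
  apply: (fmorph_inj hX); apply: (fmorph_inj j).
  have /= <- := hBX h; rewrite hE (rmorphD hX) (rmorphM hX) !hXC hE rmorphD rmorphM jK.
  by have := gE; rewrite phiE.
have [a' ha'] := composite_not_affine degA hAC hAz hAh.
have /eqP := ng a'; apply; apply: val_inj.
by rewrite cE -hE ha' hXC.
Qed.

Theorem theorem1p1 (R : realType) (A B X : ratfun R[i])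
    (degA : (2 <= rat_degree A)%N) (degB : (2 <= rat_degree B)%N)
    (degX : (2 <= rat_degree X)%N)
    (AX_XB : rat_comp A X = rat_comp X B)
    (genBX : gen_subfield (over_const [set B; X]) = setT)
    (L : splittingFieldType (gen_field (over_const [set X])))
    (j : {rmorphism ratfun R[i] -> L})
    (Lclosure : galois_closure j) :
  has_genus (j \o @rat_const R[i]) 0 \/ has_genus (j \o @rat_const R[i]) 1.
Proof. exact: (semiconjugate_genus (@pchar_num _) degA degB degX AX_XB genBX Lclosure). Qed.
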